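(* Let $\delta\in\{2\cos(\pi/k): k=4,5,6,\dots\}\cup[2,\infty)$ and let $a,b$ be real numbers with $a\neq 0\neq b$ and $\delta(a^2+b^2)+2ab=1$. Let $(\pi,\mathscr H)=(\pi^\delta_{a,b},\mathscr H)$ be the Jones representation of Thompson's group $F$ constructed from the Temperley-Lieb-Jones planar algebra with loop parameter $\delta$ and the normalized element $aR_1+bR_2$. Then for any $\varepsilon>0$ and any finite dimensional subspace $\mathscr K\subset\mathscr H$ there exists $\gamma\in F$ such that $$|\langle \pi(\gamma)\eta,\zeta\rangle|<\varepsilon\,\|\eta\|\,\|\zeta\|\quad\text{for all nonzero }\eta,\zeta\in\mathscr K.$$ In particular, $\pi$ does not contain any (nonzero) finite dimensional subrepresentation.
   Context: Thompson's group $F$ (discrete group): a binary forest with $n$ roots and $m$ leaves is a planar forest, drawn with roots at the bottom and leaves at the top (both numbered from left to right), all of whose branchings are binary; $f\circ g$ is the forest obtained by stacking $f$ on top of $g$ (roots of $f$ glued to leaves of $g$). A tree is a forest with one root. $|$ is the trivial tree, $Y$ the tree with two leaves, and $\bullet$ denotes horizontal concatenation. $F$ is the set of classes $\frac ts$ of pairs $(t,s)$ of trees with the same number of leaves, modulo the equivalence relation generated by $(t,s)\sim(f\circ t,f\circ s)$, with product $\frac ts\cdot\frac{t'}{s'}=\frac{p\circ t}{q\circ s'}$ whenever $p\circ s=q\circ t'$. Temperley-Lieb-Jones category: for $m+n$ even, $\mathrm{Rec}(m,n)$ is the complex span of non-crossing pairings (planar diagrams) of $m$ points on the bottom and $n$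 points on the top of a rectangle; composition is vertical concatenation, each closed loop being replaced by the factor $\delta$; $\dagger$ is the antilinear reflection in a horizontal line; $\bullet$ is horizontal concatenation. One takes the quotient by the kernel of the positive semidefinite forms, so that $\mathrm{Rec}(1,n)$ is a finite dimensional Hilbert space with $\langle x,y\rangle=y^\dagger\circ x\in \mathrm{Rec}(1,1)=\mathbb C$. Jones representation $\pi^\delta_{a,b}$: here $R_1=|\,|$ and $R_2={}^{\cup}_{\cap}$ in $\mathrm{Rec}(2,2)$. For $a,b\in\mathbb C$ with $\delta(|a|^2+|b|^2)+a\bar b+\bar a b=1$ put $R=aR_1+bR_2$; bending its bottom right string up to the top right gives the isometry $\rho=a(|\bullet\cup)+b(\cup\bullet|)\in\mathrm{Rec}(1,3)$. For the forest $f$ with $n$ roots whose only branching is one $Y$ at the $k$-th root set $\Phi(f)=\mathrm{id}_{2k-2}\bullet\rho\bullet\mathrm{id}_{2n-2k}\in\mathrm{Rec}(2n-1,2n+1)$, and extend by $\Phi(f\circ g)=\Phi(f)\circ\Phi(g)$. For a tree $t$ with $n$ leaves let $\mathfrak H_t$ be a copy, indexed by $t$, of the span in $\mathrm{Rec}(1,2n-1)$ of all $\Phi(s)$, $s$ a tree with $n$ leaves. $\mathscr H$ is the Hilbert space completion of the inductive limit of the $\mathfrak H_t$ along the isometries $\mathfrak H_t\to\mathfrak H_{f\circ t}$, $(t,\xi)\mapsto(f\circ t,\Phi(f)\circ\xi)$, and $\pi$ is the unitary representation determined by $\pi(\frac ts)(v,\xi)=(p\circ t,\Phi(q)\circ\xi)$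 where $p\circ s=q\circ v$. *)

(* Defs.v *)
From HB Require Import structures.
From Stdlib Require Import Relation_Operators.
From mathcomp Require Import all_boot all_order all_algebra.
From mathcomp Require Import generic_quotient sesquilinear complex.
From mathcomp Require Import all_classical all_reals all_analysis.
From mathcomp Require Import zify.

Set Implicit Arguments.
Unset Strict Implicit.
Unset Printing Implicit Defensive.

Import Order.TTheory GRing.Theory Num.Theory.
Import numFieldNormedType.Exports.

Local Open Scope quotient_scope.
Local Open Scope ring_scope.

Inductive btree := Leaf | Node of btree & btree.

Fixpoint btree_encode (t : btree) : GenTree.tree void :=
  if t is Node l r then GenTree.Node 1 [:: btree_encode l; btree_encode r]
  else GenTree.Node 0 [::].

Fixpoint btree_decode (t : GenTree.tree void) : btree :=
  if t is GenTree.Node _ [:: l; r] then Node (btree_decode l) (btree_decode r)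
  else Leaf.

Lemma btree_encodeK : cancel btree_encode btree_decode.
Proof. by elim=> //= l -> r ->. Qed.

HB.instance Definition _ := Countable.copy btree (can_type btree_encodeK).

Fixpoint tleaves (t : btree) : nat :=
  if t is Node l r then (tleaves l + tleaves r)%N else 1%N.

Fixpoint tnodes (t : btree) : nat :=
  if t is Node l r then (tnodes l + tnodes r).+1 else 0%N.

Definition leaves (f : seq btree) : nat := sumn (map tleaves f).
Definition nodes (f : seq btree) : nat := sumn (map tnodes f).

(* The roots of [f], from left to right, are glued to the leaves of [t]; only
   meaningful when [size f = tleaves t]. *)
Fixpoint graft (t : btree) (f : seq btree) : btree :=
  if t is Node l r then
    Node (graft l (take (tleaves l) f)) (graft r (drop (tleaves l) f))
  else head Leaf f.

(* [f] on top of [g] *)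
Fixpoint stack (f g : seq btree) : seq btree :=
  if g is t :: g' then
    graft t (take (tleaves t) f) :: stack (drop (tleaves t) f) g'
  else [::].

Lemma leaves_cat f g : leaves (f ++ g) = (leaves f + leaves g)%N.
Proof. by rewrite /leaves map_cat sumn_cat. Qed.

Lemma leaves_split n f :
  leaves f = (leaves (take n f) + leaves (drop n f))%N.
Proof. by rewrite -leaves_cat cat_take_drop. Qed.

Lemma leaves_nseq n : leaves (nseq n Leaf) = n.
Proof. by rewrite /leaves map_nseq sumn_nseq mul1n. Qed.

Lemma leavesE f : leaves f = (nodes f + size f)%N.
Proof.
have tE t : tleaves t = (tnodes t).+1 by elim: t => //= l -> r ->; lia.
by elim: f => //= t f; rewrite /leaves /nodes /= tE => ->; lia.
Qed.

Lemma tleaves_graft t f :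
  size f = tleaves t -> tleaves (graft t f) = leaves f.
Proof.
elim: t f => [|l IHl r IHr] f /=.
  by case: f => [|u [|]] //= _; rewrite /leaves /= addn0.
move=> sf; rewrite IHl ?IHr -?leaves_split ?size_drop ?sf ?addKn //.
by rewrite size_takel // sf leq_addr.
Qed.

Lemma size_stack f g : size (stack f g) = size g.
Proof. by elim: g f => //= t g IH f; rewrite IH. Qed.

Lemma leaves_cons t f : leaves (t :: f) = (tleaves t + leaves f)%N.
Proof. by []. Qed.

Lemma leaves_stack f g : size f = leaves g -> leaves (stack f g) = leaves f.
Proof.
elim: g f => [|t g IH] f /=; first by move/size0nil ->.
rewrite !leaves_cons => sf.
rewrite tleaves_graft ?IH -?leaves_split ?size_drop ?sf ?addKn //.
by rewrite size_takel // sf leq_addr.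
Qed.

Record forest (n m : nat) := Forest {
  trees :> seq btree;
  _ : (size trees == n) && (leaves trees == m) }.

HB.instance Definition _ n m := [isSub for @trees n m].
HB.instance Definition _ n m := [Countable of forest n m by <:].

Notation tree := (forest 1).

Lemma size_forest n m (f : forest n m) : size f = n.
Proof. by case: f => f /= /andP[/eqP]. Qed.

Lemma leaves_forest n m (f : forest n m) : leaves f = m.
Proof. by case: f => f /= /andP[_ /eqP]. Qed.

Lemma fcomp_subproof n m p (f : forest m p) (g : forest n m) :
  (size (stack f g) == n) && (leaves (stack f g) == p).
Proof.
by rewrite size_stack leaves_stack ?size_forest !leaves_forest ?eqxx.
Qed.

Definition fcomp n m p (f : forest m p) (g : forest n m) : forest n p :=
  Forest (fcomp_subproof f g).

Notation "f \oF g" := (fcomp f g) (at level 50, left associativity).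

Lemma fid_subproof n :
  (size (nseq n Leaf) == n) && (leaves (nseq n Leaf) == n).
Proof. by rewrite size_nseq leaves_nseq !eqxx. Qed.

Definition fid n : forest n n := Forest (fid_subproof n).

Lemma take_stack (f g : seq btree) n :
  take n (stack f g) = stack (take (leaves (take n g)) f) (take n g).
Proof.
elim: g f n => [|t g IH] f [|n] //=.
rewrite leaves_cons IH; congr (_ :: _).
  by rewrite take_takel ?leq_addr.
by congr stack; rewrite addnC take_drop.
Qed.

Lemma drop_stack (f g : seq btree) n :
  drop n (stack f g) = stack (drop (leaves (take n g)) f) (drop n g).
Proof.
elim: g f n => [|t g IH] f [|n] //=; rewrite ?drop0 //.
by rewrite leaves_cons IH drop_drop addnC.
Qed.

Lemma graft_stack t f g : size g = tleaves t -> size f = leaves g ->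
  graft t (stack f g) = graft (graft t g) f.
Proof.
elim: t f g => [|l IHl r IHr] f g /=.
  case: g => [|u [|]] //= _; rewrite leaves_cons addn0 => <-.
  by rewrite take_size.
move=> sg sf; have sl : size (take (tleaves l) g) = tleaves l.
  by rewrite size_takel // sg leq_addr.
rewrite take_stack drop_stack IHl ?IHr //.
- by rewrite tleaves_graft.
- by rewrite size_drop sg addKn.
- by rewrite size_drop sf (leaves_split (tleaves l) g) addKn.
- by rewrite size_takel // sf (leaves_split (tleaves l) g) leq_addr.
Qed.

Lemma stackA f g h : size g = leaves h -> size f = leaves g ->
  stack f (stack g h) = stack (stack f g) h.
Proof.
elim: h f g => [|t h IH] f g //=; rewrite leaves_cons => sg sf.
have st : size (take (tleaves t) g) = tleaves t.
  by rewrite size_takel // sg leq_addr.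
have sft : size (take (leaves (take (tleaves t) g)) f)
           = leaves (take (tleaves t) g).
  by rewrite size_takel // sf (leaves_split (tleaves t) g) leq_addr.
rewrite take_stack drop_stack graft_stack // tleaves_graft // IH //.
- by rewrite size_drop sg addKn.
- by rewrite size_drop sf (leaves_split (tleaves t) g) addKn.
Qed.

Lemma fcompA n m p q (f : forest p q) (g : forest m p) (h : forest n m) :
  f \oF (g \oF h) = (f \oF g) \oF h.
Proof. by apply: val_inj; apply: stackA; rewrite size_forest leaves_forest. Qed.

Lemma fcomp1f n m (f : forest n m) : fid m \oF f = f.
Proof.
have gE t : graft t (nseq (tleaves t) Leaf) = t.
  elim: t => //= l IHl r IHr.
  rewrite nseqD take_cat drop_cat size_nseq ltnn subnn take0 drop0 cats0.
  by rewrite IHl IHr.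
apply: val_inj => /=; have := leaves_forest f.
move: (val f) => {}f <-; elim: f => //= t g IH; rewrite leaves_cons nseqD take_cat.
by rewrite drop_cat size_nseq ltnn subnn take0 drop0 cats0 gE IH.
Qed.

Lemma fcompf1 n m (f : forest n m) : f \oF fid n = f.
Proof.
apply: val_inj => /=; have := size_forest f.
move: (val f) => {}f <-; elim: f => //= t g IH.
by rewrite drop0 IH.
Qed.

Lemma graft_inj t f g : size f = tleaves t -> size g = tleaves t ->
  graft t f = graft t g -> f = g.
Proof.
elim: t f g => [|l IHl r IHr] f g /=.
  by case: f => [|u [|]] //; case: g => [|v [|]] //= _ _ ->.
move=> sf sg [el er]; rewrite -(cat_take_drop (tleaves l) f).
rewrite -(cat_take_drop (tleaves l) g); congr (_ ++ _).
  by apply: IHl el; rewrite size_takel // ?sf ?sg leq_addr.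
by apply: IHr er; rewrite size_drop ?sf ?sg addKn.
Qed.

Lemma fcomp_inj n m p (g : forest n m) :
  injective (fun f : forest m p => f \oF g).
Proof.
move=> f f' /(congr1 val) /= e; apply: val_inj => /=.
have := size_forest f'; have := size_forest f; have := leaves_forest g.
move: (val f) (val f') (val g) e => {}f {}f' {}g + <- {m}.
elim: g f f' => [|t g IH] f f' /=.
  by move=> _ /size0nil -> /size0nil ->.
rewrite leaves_cons => -[e e'] sf sf'.
rewrite -(cat_take_drop (tleaves t) f) -(cat_take_drop (tleaves t) f').
congr (_ ++ _).
  by apply: graft_inj e; rewrite size_takel // ?sf ?sf' leq_addr.
by apply: IH e' _ _; rewrite size_drop ?sf ?sf' addKn.
Qed.

Fixpoint tjoin (t s : btree) : btree :=
  match t, s with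
  | Leaf, _ => s
  | _, Leaf => t
  | Node l r, Node l' r' => Node (tjoin l l') (tjoin r r')
  end.

Lemma tjoinC t s : tjoin t s = tjoin s t.
Proof. by elim: t s => [|l IHl r IHr] [|l' r'] //=; rewrite IHl IHr. Qed.

Lemma tjoin_refines t s :
  {f | size f = tleaves t & graft t f = tjoin t s}.
Proof.
elim: t s => [|l IHl r IHr] s; first by exists [:: s].
have [l' [r' e]] : {l' & {r' |
    tjoin (Node l r) s = Node (tjoin l l') (tjoin r r')}}.
  case: s => [|l' r']; last by exists l', r'.
  exists Leaf, Leaf; have tj u : tjoin u Leaf = u by case: u.
  by rewrite !tj.
have [f sf fE] := IHl l'; have [g sg gE] := IHr r'.
exists (f ++ g); first by rewrite size_cat sf sg.
by rewrite e /= take_cat drop_cat sf ltnn subnn take0 drop0 cats0 fE gE.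
Qed.

Lemma common_refinement n m (s : tree n) (t : tree m) :
  {k & {pq : forest n k * forest m k | pq.1 \oF s = pq.2 \oF t}}.
Proof.
case: s t => [[|s [|]] //= hs] [[|t [|]] //= ht].
have [f sf fE] := tjoin_refines s t; have [g sg gE] := tjoin_refines t s.
have sn : tleaves s = n.
  by move: hs; rewrite leaves_cons addn0 => /eqP.
have tm : tleaves t = m.
  by move: ht; rewrite leaves_cons addn0 => /eqP.
have Hf : (size f == n) && (leaves f == tleaves (tjoin s t)).
  by rewrite sf sn eqxx -fE tleaves_graft ?eqxx.
have Hg : (size g == m) && (leaves g == tleaves (tjoin s t)).
  by rewrite sg tm eqxx tjoinC -gE tleaves_graft ?eqxx.
exists (tleaves (tjoin s t)), (Forest Hf, Forest Hg).
apply: val_inj => /=; congr [:: _].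
by rewrite -{1}sf -{1}sg !take_size fE gE tjoinC.
Qed.

Definition treepair := {n : nat & (tree n * tree n)%type}.

Definition tpair n (t s : tree n) : treepair :=
  existT (fun n => (tree n * tree n)%type) n (t, s).

Inductive expands : treepair -> treepair -> Prop :=
  Expands n m (t s : tree n) (f : forest n m) :
    expands (tpair t s) (tpair (f \oF t) (f \oF s)).

Definition frac_equiv : treepair -> treepair -> Prop :=
  clos_refl_sym_trans _ expands.

Definition frac_eqb (x y : treepair) : bool := `[< frac_equiv x y >].

Lemma frac_eqb_refl : reflexive frac_eqb.
Proof. by move=> x; apply/asboolP; apply: rst_refl. Qed.

Lemma frac_eqb_sym : symmetric frac_eqb.
Proof. by move=> x y; apply/asboolP/asboolP; apply: rst_sym. Qed.

Lemma frac_eqb_trans : transitive frac_eqb.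
Proof.
by move=> y x z /asboolP xy /asboolP yz; apply/asboolP; apply: rst_trans yz.
Qed.

Canonical frac_equiv_rel :=
  EquivRel frac_eqb frac_eqb_refl frac_eqb_sym frac_eqb_trans.

Definition thompsonF := {eq_quot frac_equiv_rel}.
HB.instance Definition _ := Choice.on thompsonF.

Definition frac n (t s : tree n) : thompsonF :=
  \pi_thompsonF (tpair t s).

Lemma frac_expand n m (t s : tree n) (f : forest n m) :
  frac (f \oF t) (f \oF s) = frac t s.
Proof.
by apply/esym/eqmodP/asboolP; apply: rst_step; constructor.
Qed.

Lemma frac_surj (x : thompsonF) :
  {n & {ts : tree n * tree n | x = frac ts.1 ts.2}}.
Proof.
case E : (repr x) => [n [t s]]; exists n, (t, s).
by rewrite /frac /= -[LHS]reprK E.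
Qed.

Definition pair_mul (x y : treepair) : thompsonF :=
  let: existT n (t, s) := x in
  let: existT m (t', s') := y in
  let: existT _ (exist (p, q) _) := common_refinement s t' in
  frac (p \oF t) (q \oF s').

Lemma pair_mulE n m k (t s : tree n) (t' s' : tree m)
    (p : forest n k) (q : forest m k) :
  p \oF s = q \oF t' ->
  pair_mul (tpair t s) (tpair t' s') = frac (p \oF t) (q \oF s').
Proof.
rewrite /pair_mul /tpair => e.
case: common_refinement => l [[p' q'] /= e'].
have [j [[c d] /= cd]] := common_refinement (p' \oF s) (p \oF s).
rewrite -(frac_expand _ _ c) -[RHS](frac_expand _ _ d) !fcompA.
have -> : c \oF p' = d \oF p by apply: (@fcomp_inj _ _ _ s); rewrite -!fcompA.
have -> // : c \oF q' = d \oF q.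
by apply: (@fcomp_inj _ _ _ t'); rewrite -!fcompA -e -e'.
Qed.

Lemma pair_mul_equivl x x' y : frac_equiv x x' -> pair_mul x y = pair_mul x' y.
Proof.
elim=> {x x'} [_ _ [n m t s f]||x x' _ ->|x x' x'' _ -> _ ->] //.
case: y => l [t' s'].
have [k [[p q] /= e]] := common_refinement (f \oF s) t'.
have e' : (p \oF f) \oF s = q \oF t' by rewrite -fcompA.
apply: (etrans (pair_mulE t s' e')); apply/esym.
by apply: (etrans (pair_mulE _ s' e)); rewrite fcompA.
Qed.

Lemma pair_mul_equivr x y y' : frac_equiv y y' -> pair_mul x y = pair_mul x y'.
Proof.
elim=> {y y'} [_ _ [n m t s f]||y y' _ ->|y y' y'' _ -> _ ->] //.
case: x => l [t' s'].
have [k [[p q] /= e]] := common_refinement s' (f \oF t).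
have e' : p \oF s' = (q \oF f) \oF t by rewrite -fcompA.
apply: (etrans (pair_mulE t' s e')); apply/esym.
by apply: (etrans (pair_mulE t' _ e)); rewrite fcompA.
Qed.

Definition thompson_mul (x y : thompsonF) : thompsonF :=
  pair_mul (repr x) (repr y).

Lemma thompson_mulE n m k (t s : tree n) (t' s' : tree m)
    (p : forest n k) (q : forest m k) :
  p \oF s = q \oF t' ->
  thompson_mul (frac t s) (frac t' s') = frac (p \oF t) (q \oF s').
Proof.
move=> /(pair_mulE t s') <-; rewrite /thompson_mul.
have reprE l (u v : tree l) : frac_equiv (repr (frac u v)) (tpair u v).
  have /eqmodP/asboolP // : repr (frac u v) = tpair u v %[mod thompsonF].
  by rewrite reprK.
by rewrite (pair_mul_equivl _ (reprE _ _ _)) (pair_mul_equivr _ (reprE _ _ _)).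
Qed.

Definition thompson_one : thompsonF := frac (fid 1) (fid 1).

Definition thompson_inv (x : thompsonF) : thompsonF :=
  let: existT n (t, s) := repr x in frac s t.

Lemma frac_diag n (t : tree n) : frac t t = thompson_one.
Proof. by rewrite -[t]fcompf1 frac_expand. Qed.

Lemma thompson_mul_frac n (t s u : tree n) :
  thompson_mul (frac t s) (frac s u) = frac t u.
Proof. by rewrite (@thompson_mulE _ _ _ _ _ _ _ (fid n) (fid n)) ?fcomp1f. Qed.

Lemma thompson_mulA : associative thompson_mul.
Proof.
move=> x y z; have [n [[t s] ->]] := frac_surj x.
have [m [[t' s'] ->]] := frac_surj y; have [l [[t'' s''] ->]] := frac_surj z.
move=> /=; have [k [[p q] /= e]] := common_refinement s t'.
have [j [[u v] /= e']] := common_refinement (q \oF s') t''.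
rewrite (thompson_mulE _ _ e) (thompson_mulE _ _ e').
rewrite fcompA in e'; rewrite (thompson_mulE _ _ e').
rewrite (@thompson_mulE _ _ _ _ _ _ _ (u \oF p) (fid j)) ?fcomp1f ?fcompA //.
by rewrite -!fcompA e.
Qed.

Lemma thompson_mul1 : left_id thompson_one thompson_mul.
Proof.
move=> x; have [n [[t s] ->]] := frac_surj x.
by rewrite -(frac_diag t) thompson_mul_frac.
Qed.

Lemma thompson_mulr1 : right_id thompson_one thompson_mul.
Proof.
move=> x; have [n [[t s] ->]] := frac_surj x.
by rewrite -(frac_diag s) thompson_mul_frac.
Qed.

Lemma thompson_mulV : left_inverse thompson_one thompson_inv thompson_mul.
Proof.
move=> x; rewrite /thompson_inv -{2}[x]reprK.
by case: (repr x) => n [t s]; rewrite thompson_mul_frac frac_diag.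
Qed.

Lemma thompson_mulrV : right_inverse thompson_one thompson_inv thompson_mul.
Proof.
move=> x; rewrite /thompson_inv -{1}[x]reprK.
by case: (repr x) => n [t s]; rewrite thompson_mul_frac frac_diag.
Qed.

HB.instance Definition _ := isGroup.Build thompsonF
  thompson_mulA thompson_mul1 thompson_mulr1 thompson_mulV thompson_mulrV.

(* Boundary points of a rectangle with [m] bottom points [inl i] and [n] top
   points [inr j], both numbered from left to right. *)
Notation bpoint m n := ('I_m + 'I_n)%type.

(* Position along the boundary: the bottom from left to right, then the top
   from right to left. *)
Definition bpos m n (x : bpoint m n) : nat :=
  match x with inl i => i | inr j => (m + rev_ord j)%N end.

Definition noncrossing_pairing m n (d : {ffun bpoint m n -> bpoint m n}) :=
  [forall x, (d (d x) == x) && (d x != x)] &&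
  [forall x, forall y,
     ~~ [&& (bpos x < bpos y)%N, (bpos y < bpos (d x))%N
          & (bpos (d x) < bpos (d y))%N]].

Record diagram (m n : nat) := Diagram {
  partner :> {ffun bpoint m n -> bpoint m n};
  _ : noncrossing_pairing partner }.

HB.instance Definition _ m n := [isSub for @partner m n].
HB.instance Definition _ m n := [Finite of diagram m n by <:].

Lemma diagram_subproof m n (d : bpoint m n -> bpoint m n) :
    involutive d -> (forall x, d x <> x) ->
    (forall x y, (bpos x < bpos y)%N -> (bpos y < bpos (d x))%N ->
       (bpos (d x) < bpos (d y))%N -> False) ->
  noncrossing_pairing (finfun d).
Proof.
move=> dK dN dX; apply/andP; split.
  by apply/forallP => x; rewrite !ffunE dK eqxx; apply/eqP/dN.
apply/forallP => x; apply/forallP => y; rewrite !ffunE.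
by apply/negP => /and3P[]; apply: dX.
Qed.

Lemma partnerK m n (d : diagram m n) : involutive d.
Proof. by case: d => d /= /andP[/forallP H _] x; have /andP[/eqP] := H x. Qed.

Lemma partner_neq m n (d : diagram m n) x : d x <> x.
Proof. by case: d => d /= /andP[/forallP H _]; have /andP[_ /eqP] := H x. Qed.

Lemma partner_nc m n (d : diagram m n) x y :
  (bpos x < bpos y)%N -> (bpos y < bpos (d x))%N ->
  (bpos (d x) < bpos (d y))%N -> False.
Proof.
case: d => d /= /andP[_ /forallP H] h1 h2 h3.
by have /forallP/(_ y) := H x; rewrite h1 h2 h3.
Qed.

Definition swap_point m n (x : bpoint m n) : bpoint n m :=
  match x with inl i => inr i | inr j => inl j end.

Lemma swap_pointK m n : cancel (@swap_point m n) (@swap_point n m).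
Proof. by case. Qed.

Lemma bpos_swap m n (x : bpoint m n) :
  (bpos (swap_point x) + bpos x).+1 = (m + n)%N.
Proof. by case: x => i /=; have := ltn_ord i; lia. Qed.

Definition id_partner n (x : bpoint n n) : bpoint n n := swap_point x.

Lemma id_diagram_subproof n : noncrossing_pairing (finfun (@id_partner n)).
Proof.
apply: diagram_subproof => [x|[]//|x y].
  exact: swap_pointK.
by have := bpos_swap x; have := bpos_swap y; rewrite /id_partner; lia.
Qed.

Definition id_diagram n : diagram n n := Diagram (id_diagram_subproof n).

Definition cup_partner (x : bpoint 0 2) : bpoint 0 2 :=
  match x with inl i => inl i | inr j => inr (rev_ord j) end.

Lemma cup_diagram_subproof : noncrossing_pairing (finfun cup_partner).
Proof.
apply: diagram_subproof.
- by case=> [[]|j] //=; rewrite rev_ordK.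
- case=> [[]|j] //= [] /(congr1 val) /=; have := ltn_ord j.
  by case: (val j) => [|[|]].
- case=> [[]|i] //; case=> [[]|j] //=.
  by have := ltn_ord i; have := ltn_ord j; lia.
Qed.

Definition cup_diagram : diagram 0 2 := Diagram cup_diagram_subproof.

Definition flip_partner m n (d : diagram m n) (x : bpoint n m) : bpoint n m :=
  swap_point (d (swap_point x)).

Lemma flip_diagram_subproof m n (d : diagram m n) :
  noncrossing_pairing (finfun (flip_partner d)).
Proof.
rewrite /flip_partner; apply: diagram_subproof =>
  [x|x /(congr1 (@swap_point _ _))|x y].
- by rewrite swap_pointK partnerK swap_pointK.
- by rewrite swap_pointK; apply: partner_neq.
move=> h1 h2 h3.
apply: (@partner_nc _ _ d (d (swap_point y)) (d (swap_point x))).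
all: rewrite ?partnerK; move: h1 h2 h3.
all: have := bpos_swap (swap_point x); have := bpos_swap (swap_point y).
all: have := bpos_swap (d (swap_point x)); have := bpos_swap (d (swap_point y)).
all: by rewrite !swap_pointK; lia.
Qed.

Definition flip_diagram m n (d : diagram m n) : diagram n m :=
  Diagram (flip_diagram_subproof d).

Definition lpoint m1 m2 n1 n2 (x : bpoint m1 n1) : bpoint (m1 + m2) (n1 + n2) :=
  match x with inl i => inl (lshift m2 i) | inr j => inr (lshift n2 j) end.

Definition rpoint m1 m2 n1 n2 (x : bpoint m2 n2) : bpoint (m1 + m2) (n1 + n2) :=
  match x with inl i => inl (rshift m1 i) | inr j => inr (rshift n1 j) end.

Definition side_point m1 m2 n1 n2 (x : bpoint (m1 + m2) (n1 + n2)) :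
    bpoint m1 n1 + bpoint m2 n2 :=
  match x with
  | inl i => match fintype.split i with
             | inl i1 => inl (inl i1) | inr i2 => inr (inl i2) end
  | inr j => match fintype.split j with
             | inl j1 => inl (inr j1) | inr j2 => inr (inr j2) end
  end.

Definition juxt_partner m1 m2 n1 n2 (d1 : diagram m1 n1) (d2 : diagram m2 n2)
    (x : bpoint (m1 + m2) (n1 + n2)) : bpoint (m1 + m2) (n1 + n2) :=
  match side_point x with
  | inl y => lpoint m2 n2 (d1 y)
  | inr y => rpoint m1 n1 (d2 y)
  end.

Variant side_spec m1 m2 n1 n2 : bpoint (m1 + m2) (n1 + n2) ->
    bpoint m1 n1 + bpoint m2 n2 -> Type :=
  | SideL y : side_spec (lpoint m2 n2 y) (inl y)
  | SideR y : side_spec (rpoint m1 n1 y) (inr y).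

Lemma lpointK m1 m2 n1 n2 (y : bpoint m1 n1) :
  side_point (lpoint m2 n2 y) = inl y.
Proof.
by case: y => i /=; case: split_ordP => j /eqP;
  rewrite ?eq_lshift ?eq_lrshift // => /eqP ->.
Qed.

Lemma rpointK m1 m2 n1 n2 (y : bpoint m2 n2) :
  side_point (rpoint m1 n1 y) = inr y.
Proof.
by case: y => i /=; case: split_ordP => j /eqP;
  rewrite ?eq_rshift ?eq_rlshift // => /eqP ->.
Qed.

Lemma side_pointP m1 m2 n1 n2 (x : bpoint (m1 + m2) (n1 + n2)) :
  side_spec x (side_point x).
Proof.
case: x => i /=; case: split_ordP => j ->.
- exact: (SideL _ _ (inl j)).
- exact: (SideR _ _ (inl j)).
- exact: (SideL _ _ (inr j)).
- exact: (SideR _ _ (inr j)).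
Qed.

Lemma juxt_diagram_subproof m1 m2 n1 n2 (d1 : diagram m1 n1)
    (d2 : diagram m2 n2) : noncrossing_pairing (finfun (juxt_partner d1 d2)).
Proof.
have posL (y : bpoint m1 n1) : bpos (lpoint m2 n2 y) = bpos y :> nat
    /\ (bpos y < m1)%N \/
    bpos (lpoint m2 n2 y) = (bpos y + (m2 + n2))%N /\ (m1 <= bpos y)%N.
  by case: y => i /=; have := ltn_ord i; lia.
have posR (y : bpoint m2 n2) : bpos (rpoint m1 n1 y) = (m1 + bpos y)%N
    /\ (bpos y < m2 + n2)%N.
  by case: y => i /=; have := ltn_ord i; lia.
apply: diagram_subproof; rewrite /juxt_partner.
- by move=> x; case: (side_pointP x) => y; rewrite ?lpointK ?rpointK partnerK.
- move=> x; case: (side_pointP x) => y /(congr1 (@side_point _ _ _ _));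
    by rewrite ?lpointK ?rpointK => -[/partner_neq].
- move=> x y; case: (side_pointP x) => {}x; case: (side_pointP y) => {}y h1 h2 h3.
  + apply: (@partner_nc _ _ d1 x y); move: h1 h2 h3;
    have := posL x; have := posL y; have := posL (d1 x); have := posL (d1 y); lia.
  + move: h1 h2 h3.
    have := posL x; have := posR y; have := posL (d1 x); have := posR (d2 y); lia.
  + move: h1 h2 h3.
    have := posR x; have := posL y; have := posR (d2 x); have := posL (d1 y); lia.
  + apply: (@partner_nc _ _ d2 x y); move: h1 h2 h3;
    have := posR x; have := posR y; have := posR (d2 x); have := posR (d2 y); lia.
Qed.

Definition juxt_diagram m1 m2 n1 n2 (d1 : diagram m1 n1) (d2 : diagram m2 n2) :
    diagram (m1 + m2) (n1 + n2) := Diagram (juxt_diagram_subproof d1 d2).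

(* Vertical concatenation of [d1] on top of [d2].  The strands of both diagrams
   are the edges of a graph on the bottom points of [d2], the [n] glued points
   and the top points of [d1]. *)
Notation gpoint m n p := (('I_m + 'I_n) + 'I_p)%type.

Section Glue.
Variables (m n p : nat) (d1 : diagram n p) (d2 : diagram m n).

Definition lower_point (x : bpoint m n) : gpoint m n p := inl x.

Definition upper_point (x : bpoint n p) : gpoint m n p :=
  match x with inl i => inl (inr i) | inr j => inr j end.

Definition outer_point (x : bpoint m p) : gpoint m n p :=
  match x with inl i => inl (inl i) | inr j => inr j end.

Definition glued : rel (gpoint m n p) := fun u v =>
  [exists x, (u == lower_point x) && (v == lower_point (d2 x))] ||
  [exists x, (u == upper_point x) && (v == upper_point (d1 x))].

(* [d] is the pairing of the outer points obtained by following the strands;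
   exactly one diagram [d] has this property. *)
Definition is_composite (d : diagram m p) : bool :=
  [forall x, connect glued (outer_point x) (outer_point (d x))].

(* The closed loops are the components that contain no outer point. *)
Definition closed_loops : nat :=
  n_comp glued [pred u | [forall x, ~~ connect glued u (outer_point x)]].

End Glue.

Section Rec.
Variable R : realType.
Local Notation C := R[i].

Definition Rec (m n : nat) := {ffun diagram m n -> C^o}.

HB.instance Definition _ m n := GRing.Lmodule.on (Rec m n).

Definition dbasis m n (d : diagram m n) : Rec m n := [ffun d' => (d' == d)%:R].

Definition rid n : Rec n n := dbasis (id_diagram n).

Definition rcup : Rec 0 2 := dbasis cup_diagram.

(* [x] on top of [y] *)
Definition rcomp (delta : C) m n p (x : Rec n p) (y : Rec m n) : Rec m p :=
  [ffun d => \sum_d1 \sum_(d2 | is_composite d1 d2 d)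
               x d1 * y d2 * delta ^+ closed_loops d1 d2].

Definition rjuxt m1 m2 n1 n2 (x : Rec m1 n1) (y : Rec m2 n2) :
    Rec (m1 + m2) (n1 + n2) :=
  \sum_d1 \sum_d2 (x d1 * y d2 : C) *: dbasis (juxt_diagram d1 d2).

Definition rdagger m n (x : Rec m n) : Rec n m :=
  [ffun d => (x (flip_diagram d))^*].

Definition rcast m n m' n' (e : (m = m') * (n = n')) (x : Rec m n) : Rec m' n' :=
  let: erefl in _ = n' := e.2 return Rec m' n' in
  let: erefl in _ = m' := e.1 return Rec m' n in x.

(* [id_diagram 1] is the only diagram in [Rec 1 1], so that its coefficient
   identifies [Rec 1 1] with C. *)
Definition rdot (delta : C) n (x y : Rec 1 n) : C :=
  rcomp delta (rdagger y) x (id_diagram 1).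

(* A root or leaf is a strand, and so is each gap between two of them. *)
Definition strands (n : nat) : nat := n.*2.-1.

(* [a R_1 + b R_2] with its bottom right string bent up to the top right, where
   [R_1] is two vertical strands and [R_2] is a cup above a cap *)
Definition rho (a b : C) : Rec 1 3 :=
  a *: (rjuxt (rid 1) rcup : Rec 1 3) + b *: (rjuxt rcup (rid 1) : Rec 1 3).

Lemma strands_caret n (i : 'I_n) :
  ((i.*2 + 1) + (n - i.+1).*2 = strands n)%N *
  ((i.*2 + 3) + (n - i.+1).*2 = strands n.+1)%N.
Proof. by have := ltn_ord i; rewrite /strands; split; lia. Qed.

(* The image of the forest with [n] roots whose only branching is one caret at
   the root [i]; roots are numbered from 0. *)
Definition Phi_caret (a b : C) n (i : 'I_n) : Rec (strands n) (strands n.+1) :=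
  rcast (strands_caret i)
    (rjuxt (rjuxt (rid i.*2) (rho a b)) (rid (n - i.+1).*2)).

Definition is_node (t : btree) : bool := if t is Node _ _ then true else false.

(* [f] is the composition of [prune f] with the forest whose only branching is
   one caret at the root [find is_node f]; see [pruneE]. *)
Fixpoint prune (f : seq btree) : seq btree :=
  match f with
  | [::] => [::]
  | Leaf :: f' => Leaf :: prune f'
  | Node l r :: f' => l :: r :: f'
  end.

(* [f] has [n] roots and [k] branchings, hence [k + n] leaves; the value is the
   composite of the images of its branchings.  [NatTrec.add k n] is [k + n], in a
   form for which the recursive call is well typed.  The last case does not occur
   for such an [f]. *)
Fixpoint Phi_rec (a b delta : C) (k n : nat) (f : seq btree) :
    Rec (strands n) (strands (NatTrec.add k n)) :=
  match k return Rec (strands n) (strands (NatTrec.add k n)) with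
  | 0 => rid (strands n)
  | k'.+1 =>
    if insub (find is_node f) is Some i then
      rcomp delta (Phi_rec a b delta k' n.+1 (prune f)) (Phi_caret a b i)
    else 0
  end.

Lemma strands_forest n m (f : forest n m) :
  strands (NatTrec.add (nodes f) n) = strands m.
Proof. by rewrite NatTrec.addE -{2}(size_forest f) -leavesE leaves_forest. Qed.

Definition Phi (a b delta : C) n m (f : forest n m) :
    Rec (strands n) (strands m) :=
  rcast (erefl, strands_forest f) (Phi_rec a b delta (nodes f) n f).

End Rec.

Definition caret n (i : nat) : seq btree :=
  nseq i Leaf ++ Node Leaf Leaf :: nseq (n - i.+1) Leaf.

Lemma pruneE f : has is_node f ->
  f = stack (prune f) (caret (size f) (find is_node f)).
Proof.
elim: f => //= t f IH; case: t => [|l r] /= => [/IH e|_].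
  by rewrite /caret /= subSS -/(caret _ _) drop0 -e.
rewrite /caret /= subSS subn0 drop0; congr (_ :: _).
by elim: f {IH} => //= t f IH; rewrite drop0 -IH.
Qed.

Section Span.
Variables (K : pzRingType) (V : lmodType K).

Definition lspan (S : set V) : set V :=
  [set x | exists k (c : 'I_k -> K) (v : 'I_k -> V),
     (forall i, S (v i)) /\ x = \sum_i c i *: v i].

Definition findim_subspace (W : set V) : Prop :=
  exists k (v : 'I_k -> V), W = lspan (range v).

End Span.

Section JonesRepresentation.
Variables (R : realType) (delta a b : R[i]).

Definition tree_space n : set (Rec R 1 (strands n)) :=
  lspan [set Phi a b delta s | s in [set: tree n]].

(* [H], with inner product [dot], is the Hilbert space completion of the
   inductive limit of the spaces [tree_space n] indexed by trees [t];
   [iota t xi] is the class of [(t, xi)].  Since [iota t] preserves the forms, it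
   factors through the quotient of [tree_space n] by the kernel of [rdot]. *)
Record jones_space (H : completeNormedModType R[i]) (dot : {dot H for Num.conj})
    (iota : forall n, tree n -> Rec R 1 (strands n) -> H) : Prop := {
  jones_norm : forall x, `|x| ^+ 2 = dot x x;
  jones_linear : forall n (t : tree n) c xi eta,
    tree_space xi -> tree_space eta ->
    iota n t (c *: xi + eta) = c *: iota n t xi + iota n t eta;
  jones_isometry : forall n (t : tree n) xi eta,
    tree_space xi -> tree_space eta ->
    dot (iota n t xi) (iota n t eta) = rdot delta xi eta;
  jones_limit : forall n m (t : tree n) (f : forest n m) xi, tree_space xi ->
    iota m (f \oF t) (rcomp delta (Phi a b delta f) xi) = iota n t xi;
  jones_dense : dense [set x | exists n (t : tree n) xi,
    tree_space xi /\ x = iota n t xi] }.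

Record jones_representation (H : completeNormedModType R[i])
    (dot : {dot H for Num.conj})
    (iota : forall n, tree n -> Rec R 1 (strands n) -> H)
    (rep : thompsonF -> {linear H -> H}) : Prop := {
  jones_rep_space : jones_space dot iota;
  jones_rep_one : forall x, rep 1%g x = x;
  jones_rep_mul : forall g h x, rep (g * h)%g x = rep g (rep h x);
  jones_rep_unitary : forall g x y, dot (rep g x) (rep g y) = dot x y;
  jones_rep_frac : forall n m k (t s : tree n) (v : tree m) (p : forest n k)
      (q : forest m k) xi,
    tree_space xi -> p \oF s = q \oF v ->
    rep (frac t s) (iota m v xi) =
      iota k (p \oF t) (rcomp delta (Phi a b delta q) xi) }.

End JonesRepresentation.

(* Main.v *)
Require Import Defs.
From mathcomp Require Import all_boot all_order all_algebra.
From mathcomp Require Import sesquilinear complex.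
From mathcomp Require Import all_classical all_reals all_analysis.
From mathcomp Require Import zify ring lra.

Set Implicit Arguments.
Unset Strict Implicit.
Unset Printing Implicit Defensive.

Import Order.TTheory GRing.Theory Num.Theory.
Import numFieldNormedType.Exports.

(* A planar pairing is determined by the two-colourings of its endpoints that are
   constant on its strands, and the number of closed loops of a composite is the
   binary logarithm of the number of colourings of the glued points that extend
   the zero colouring of the outer points; so all diagrammatic identities reduce
   to counting bit sequences.  The image of a forest is a sum over words of cups,
   and grafting the three-leaf trees ((.,.),.) and (.,(.,.)) on the last leaf of
   two trees s and s' multiplies <Phi(s), Phi(s')> by their own pairing
   c = 1 - a^2 b^2 (delta^2 - 1).  The normalization and delta >= sqrt 2 give
   |c| < 1.  Since H is topologically spanned by the F-orbit of the vacuum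
   vector, and finitely many elements of F share a numerator t, iterating the
   grafting on t yields, for each k, an element g of F with
   <pi(g) x, y> = c^k <x, y> on a subspace as close to K as desired. *)

(** * Words of cups *)

(* A word [c_1; ...; c_k] denotes the diagram without caps obtained by inserting
   cups at the positions c_1 (the lowest), ..., c_k (the topmost).  Since the
   strands of such a diagram carry the top colouring [f] down to the bottom,
   [reduce w f] is the bottom colouring if [f] is constant on all the cups. *)
Definition remove_pair (c : nat) (f : seq bool) : option (seq bool) :=
  if nth false f c == nth false f c.+1 then Some (take c f ++ drop c.+2 f)
  else None.

Definition reduce (w : seq nat) (f : seq bool) : option (seq bool) :=
  foldr (fun c => obind (remove_pair c)) (Some f) w.

(** With [m] points present there are [m.+1] gaps, numbered from 0, for the next cup, which adds two
    points. *)
Fixpoint valid (m : nat) (w : seq nat) : bool :=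
  if w is c :: w' then (c <= m) && valid m.+2 w' else true.

Lemma reduce_cat w e f : reduce (w ++ e) f = obind (reduce w) (reduce e f).
Proof.
rewrite /reduce foldr_cat; case: (foldr _ _ e) => [h|] //=.
by elim: w => //= c w ->.
Qed.

Lemma valid_rcons m w c :
  valid m (rcons w c) = valid m w && (c <= m + (size w).*2).
Proof.
elim: w m => [|c' w IH] m /=; first by rewrite addn0 andbT.
by rewrite IH andbA doubleS !addnS !addSn.
Qed.

Lemma size_remove_pair c f g : c.+1 < size f -> remove_pair c f = Some g ->
  (size g).+2 = size f.
Proof.
rewrite /remove_pair; case: ifP => // _ cf [<-].
by rewrite size_cat size_take size_drop; case: ltnP => ?; lia.
Qed.

Lemma size_reduce m w f g : valid m w -> size f = m + (size w).*2 ->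
  reduce w f = Some g -> size g = m.
Proof.
elim: w m g => [|c w IH] m g /=; first by rewrite addn0 => _ <- [<-].
move=> /andP[cm vw] sf; case E: (reduce w f) => [h|] //= rh.
have sh : size h = m.+2 by apply: IH E; rewrite // sf doubleS !addSn !addnS.
by have := size_remove_pair _ rh; rewrite sh; lia.
Qed.

Definition parity (f : seq bool) : bool := odd (count id f).

(** The two deleted bits are equal, so the parity is an invariant. For a word with one bottom point
    it forces the bottom bit. *)
Lemma parity_remove_pair c f g : c.+1 < size f -> remove_pair c f = Some g ->
  parity g = parity f.
Proof.
rewrite /remove_pair; case: ifP => // /eqP e cf [<-]; rewrite /parity.
rewrite -{3}(cat_take_drop c f) (drop_nth false (ltnW cf)).
rewrite (drop_nth false cf) !count_cat /= -e.
by rewrite !oddD; case: (nth _ _ _); case: odd; case: odd.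
Qed.

Lemma parity_reduce m w f g : valid m w -> size f = m + (size w).*2 ->
  reduce w f = Some g -> parity g = parity f.
Proof.
elim: w m g => [|c w IH] m g /=; first by move=> _ _ [<-].
move=> /andP[cm vw] sf; case E: (reduce w f) => [h|] //= rh.
have sf' : size f = m.+2 + (size w).*2 by rewrite sf doubleS !addSn !addnS.
rewrite (parity_remove_pair _ rh) ?(IH _ _ vw sf' E) //.
by rewrite (size_reduce vw sf' E) !ltnS.
Qed.

Lemma remove_pair_cat c f0 f :
  remove_pair (size f0 + c) (f0 ++ f) = omap (cat f0) (remove_pair c f).
Proof.
rewrite /remove_pair -!addnS !nth_cat !ltnNge !leq_addr /= !addKn;
  case: ifP => //= _.
by rewrite take_cat drop_cat !ltnNge !leq_addr /= !addKn catA.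
Qed.

Lemma reduce_shift w f0 f :
  reduce (map (addn (size f0)) w) (f0 ++ f) = omap (cat f0) (reduce w f).
Proof.
elim: w => //= c w; rewrite -/(reduce _ (f0 ++ f)) => ->.
by rewrite -/(reduce w f); case: (reduce w f) => //= h; rewrite remove_pair_cat.
Qed.

Fixpoint bitseqs (n : nat) : seq (seq bool) :=
  if n is n'.+1 then map (cons true) (bitseqs n') ++ map (cons false) (bitseqs n')
  else [:: [::]].

Lemma mem_bitseqs n f : (f \in bitseqs n) = (size f == n).
Proof.
elim: n f => [|n IH] [|b f] //=; rewrite mem_cat.
  by apply/negbTE; rewrite negb_or; apply/andP; split; apply/mapP => -[].
have inj b' : injective (cons b' : seq bool -> _) by move=> ? ? [].
have ne b' f' : b <> b' -> (b :: f \in map (cons b') f') = false.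
  by move=> bb'; apply/negbTE/mapP => -[h _ [/bb']].
by rewrite eqSS -IH; case: b ne => ne; rewrite (mem_map (inj _)) ne // orbF.
Qed.

Lemma uniq_bitseqs n : uniq (bitseqs n).
Proof.
elim: n => //= n IH; rewrite cat_uniq !map_inj_uniq ?IH /=; try by move=> ? ? [].
by rewrite andbT; apply/hasPn => _ /mapP[f _ ->]; apply/mapP => -[].
Qed.

(** Loop counts arise as cardinals of sets of tuples; lists of bit sequences can be split along
    concatenations and evaluated. *)
Lemma count_bitseqs_tuple n (P : pred (seq bool)) :
  #|[set f : n.-tuple bool | P f]| = count P (bitseqs n).
Proof.
have /permP <- : perm_eq (map val (enum {: n.-tuple bool})) (bitseqs n).
  apply: uniq_perm; rewrite ?uniq_bitseqs ?(map_inj_uniq val_inj) ?enum_uniq //.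
  move=> f; rewrite mem_bitseqs; apply/mapP/eqP => [[t _ ->]|/eqP sf].
    exact: size_tuple.
  by exists (Tuple sf); rewrite ?mem_enum.
rewrite -sum1_count big_map big_enum_cond /= -sum1_card.
by apply: eq_bigl => f; rewrite inE.
Qed.

Lemma count_bitseqs_cat m n (P : pred (seq bool)) :
  count P (bitseqs (m + n)) =
  \sum_(f <- bitseqs m) count (fun h => P (f ++ h)) (bitseqs n).
Proof.
elim: m P => [|m IH] P /=; first by rewrite big_seq1.
by rewrite count_cat !count_map !IH big_cat !big_map.
Qed.

(* [closed_count n w w'] is [2 ^ l] where [l] is the number of closed loops of
   the pairing of the diagrams of [w] and [w']. *)
Definition closed_count n (w w' : seq nat) : nat :=
  count (fun f => (reduce w f == Some [:: false]) &&
    (reduce w' f == Some [:: false])) (bitseqs n).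

(** Five is [strands 3], the number of top points of a three-leaf tree. Both values of [b] matter: a
    strand of a larger diagram on which such a tree is grafted need not carry the zero colour. *)
Definition local_count (b : bool) e e' : nat :=
  count (fun f => (reduce e f == Some [:: b]) && (reduce e' f == Some [:: b]))
    (bitseqs 5).

(** Fix the colours [f0] of the first [n] points. By parity [e] and [e'] reduce the last five to the
    same bit, and each bit comes from [2 ^ l] colourings; so the five points act as one point
    counted [2 ^ l] times. *)
Lemma closed_count_extend n w w' e e' l :
    size e = 2 -> size e' = 2 -> valid 1 e -> valid 1 e' ->
    (forall b, local_count b e e' = 2 ^ l) ->
  closed_count (n + 5) (w ++ map (addn n) e) (w' ++ map (addn n) e') =
    (2 ^ l * closed_count (n + 1) w w')%N.
Proof.
move=> se se' ve ve' le; rewrite /closed_count !count_bitseqs_cat big_distrr.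
rewrite [LHS]big_seq [RHS]big_seq; apply: eq_bigr => f0.
rewrite mem_bitseqs => /eqP <-.
rewrite [RHS]/= addn0 mulnDr.
(* [Q [:: b]] is the condition left to [w] and [w'] once the five points are reduced to the bit
   [b]. *)
pose Q (h : seq bool) :=
  (reduce w (f0 ++ h) == Some [:: false]) &&
  (reduce w' (f0 ++ h) == Some [:: false]).
(* The two bits select disjoint sets of [2 ^ l] colourings, so the weighted sum is a single
   count. *)
have -> : (2 ^ l * Q [:: true] + 2 ^ l * Q [:: false] =
   count (fun f => [exists b, [&& reduce e f == Some [:: b],
      reduce e' f == Some [:: b] & Q [:: b]]]) (bitseqs 5))%N.
  rewrite -{1}(le true) -(le false) /local_count -!sum1_count.
  rewrite !big_distrl /= !(big_mkcond (fun f => _ && _)) -big_split /=.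
  rewrite sum1_count -sum1_count [in RHS]big_mkcond /=.
  apply: eq_bigr => f _.
  have -> : [exists b, [&& reduce e f == Some [:: b],
      reduce e' f == Some [:: b] & Q [:: b]]] =
    [&& reduce e f == Some [:: true], reduce e' f == Some [:: true]
      & Q [:: true]] ||
    [&& reduce e f == Some [:: false], reduce e' f == Some [:: false]
      & Q [:: false]].
    apply/existsP/orP => [[[]]|[]];
      [by left | by right | by exists true | by exists false].
  case: (reduce e f) (reduce e' f) => [[|[] [|? ?]]|] [[|[] [|? ?]]|] //;
    rewrite ?andbF //; by case: (Q _).
rewrite [LHS](eq_in_count (a2 := fun f => [exists b, [&& reduce e f == Some [:: b],
      reduce e' f == Some [:: b] & Q [:: b]]])) // => f.
rewrite mem_bitseqs => /eqP sf; rewrite !reduce_cat !reduce_shift.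
have sfe : size f = 1 + (size e).*2 by rewrite se.
have sfe' : size f = 1 + (size e').*2 by rewrite se'.
case E: (reduce e f) => [h|] /=; last first.
  by apply/esym/existsP => -[].
case E': (reduce e' f) => [h'|] /=; last first.
  by rewrite andbF; apply/esym/existsP => -[b]; rewrite andbF.
(* Both results are single bits with the parity of [f], hence equal. *)
have := parity_reduce ve sfe E; rewrite -(parity_reduce ve' sfe' E').
move: (size_reduce ve sfe E) (size_reduce ve' sfe' E').
case: h h' {E E'} => [|x []] // [|y []] //= _ _.
rewrite /parity /=; case: x y => -[] //= _; apply/idP/existsP.
- by move=> H; exists true; rewrite eqxx.
- by case=> b /and3P[/eqP[<-]].
- by move=> H; exists false; rewrite eqxx.
- by case=> b /and3P[/eqP[<-]].
Qed.

(** * Colourings of diagrams *)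

Definition colour m n (g f : seq bool) (x : bpoint m n) : bool :=
  match x with inl i => nth false g i | inr j => nth false f j end.

Definition compat m n (d : diagram m n) (g f : seq bool) : bool :=
  [forall x, colour g f (d x) == colour g f x].

Lemma compatP m n (d : diagram m n) g f :
  reflect (forall x, colour g f (d x) = colour g f x) (compat d g f).
Proof. by apply: (iffP forallP) => H x; apply/eqP. Qed.

Lemma colourK m n (phi : bpoint m n -> bool) :
  colour [tuple phi (inl i) | i < m] [tuple phi (inr j) | j < n] =1 phi.
Proof. by case=> i; rewrite /colour -tnth_nth tnth_mktuple. Qed.

(** The test colouring is the indicator of one strand [{x, d x}]: it forces [d' x] into that strand,
    and [d' x] is not [x]. *)
Lemma compat_inj m n (d d' : diagram m n) :
    (forall (g : m.-tuple bool) (f : n.-tuple bool),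
      compat d g f -> compat d' g f) ->
  d = d'.
Proof.
move=> H; apply/val_inj/ffunP => x.
pose phi y := (y == x) || (y == d x).
have /compatP/(_ x) : compat d' [tuple phi (inl i) | i < m]
    [tuple phi (inr j) | j < n].
  apply: H; apply/compatP => y; rewrite !colourK /phi.
  by rewrite (inv_eq (partnerK d)) orbC (can_eq (partnerK d)).
rewrite !colourK /phi eqxx /= => /orP[/eqP/partner_neq //|/eqP->//].
Qed.

Section InsertCup.
Variables (m n : nat) (d : diagram m n) (c : 'I_n.+1).

Let c0 : 'I_n.+2 := widen_ord (leqnSn _) c.

(** The new cup joins [c0] and [lift c0 c], the top points numbered [c] and [c.+1]; the nested lifts
    make the old top points skip both. *)
Definition ins_point (x : bpoint m n) : bpoint m n.+2 :=
  match x with inl i => inl i | inr j => inr (lift c0 (lift c j)) end.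

Definition ins_partner (x : bpoint m n.+2) : bpoint m n.+2 :=
  match x with
  | inl i => ins_point (d (inl i))
  | inr j =>
    match unlift c0 j with
    | None => inr (lift c0 c)
    | Some k => if unlift c k is Some l then ins_point (d (inr l)) else inr c0
    end
  end.

Variant ins_spec : bpoint m n.+2 -> bpoint m n.+2 -> Type :=
  | InsOld y : ins_spec (ins_point y) (ins_point (d y))
  | InsL : ins_spec (inr c0) (inr (lift c0 c))
  | InsR : ins_spec (inr (lift c0 c)) (inr c0).

Lemma ins_partnerP x : ins_spec x (ins_partner x).
Proof.
case: x => [i|j] /=; first exact: (InsOld (inl i)).
case: unliftP => [k|] ->; last exact: InsL.
case: unliftP => [l|] ->; last exact: InsR.
exact: (InsOld (inr l)).
Qed.

Lemma ins_partner_old y : ins_partner (ins_point y) = ins_point (d y).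
Proof. by case: y => i //=; rewrite !liftK. Qed.

Lemma ins_partner_l : ins_partner (inr c0) = inr (lift c0 c).
Proof. by rewrite /= unlift_none. Qed.

Lemma ins_partner_r : ins_partner (inr (lift c0 c)) = inr c0.
Proof. by rewrite /= liftK unlift_none. Qed.

Lemma ins_point_inj : injective ins_point.
Proof.
move=> [i|i] [j|j] //= [] => [->|] // /(can_inj (bumpK _)).
by move=> /(can_inj (bumpK _))/val_inj ->.
Qed.

Lemma insert_subproof : noncrossing_pairing (finfun ins_partner).
Proof.
(* Top points are counted from right to left, so the cup takes the adjacent positions [m + (n - c)]
   and its successor, right end first. Earlier points keep their position and later ones move by
   two, so no new crossing appears. *)
have pos y : (bpos (ins_point y) = bpos y :> nat /\ (bpos y < m + (n - c)))%N \/
    (bpos (ins_point y) = (bpos y).+2 /\ (m + (n - c) <= bpos y))%N.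
  case: y => i /=; first by left; split=> //; have := ltn_ord i; lia.
  by have := ltn_ord i; have := ltn_ord c; rewrite /bump; lia.
have posl : bpos (inr c0 : bpoint m n.+2) = (m + (n - c)).+1.
  by rewrite /=; have := ltn_ord c; lia.
have posr : bpos (inr (lift c0 c) : bpoint m n.+2) = (m + (n - c))%N.
  by rewrite /= /bump; have := ltn_ord c; lia.
apply: diagram_subproof => [x|x|x y].
- case: (ins_partnerP x) => [y||].
  + by rewrite ins_partner_old partnerK.
  + exact: ins_partner_r.
  + exact: ins_partner_l.
- case: (ins_partnerP x) => [y /ins_point_inj/partner_neq//||];
    move=> /(congr1 (fun z => if z is inr k then val k else 0%N)) /=;
    rewrite /bump; lia.
case: (ins_partnerP x) => [z||]; case: (ins_partnerP y) => [t||];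
  rewrite ?posl ?posr => h1 h2 h3; try lia.
- apply: (@partner_nc _ _ d z t); have := pos z; have := pos t;
    have := pos (d z); have := pos (d t); lia.
Qed.

Definition insert_cup : diagram m n.+2 := Diagram insert_subproof.

Lemma colour_ins g f y : size f = n.+2 ->
  colour g f (ins_point y) = colour g (take c f ++ drop c.+2 f) y.
Proof.
case: y => //= j sf; rewrite nth_cat size_takel; last first.
  by rewrite sf; have := ltn_ord c; lia.
case: (ltnP j c) => jc.
  by rewrite nth_take //; congr nth; rewrite /bump; lia.
by rewrite nth_drop; congr nth; rewrite /bump; lia.
Qed.

(** This is the diagrammatic meaning of [remove_pair]: the cup demands equal bits, and the other
    strands see the remaining ones. *)
Lemma compat_insert g f : size f = n.+2 ->
  compat insert_cup g f = (nth false f c == nth false f c.+1) &&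
    compat d g (take c f ++ drop c.+2 f).
Proof.
have cE : nth false f (lift c0 c) = nth false f c.+1.
  by congr nth; rewrite /= /bump leqnn.
move=> sf; apply/compatP/andP => [H|[/eqP e /compatP H] x].
  split; first by have := H (inr c0); rewrite ffunE ins_partner_l /= cE => ->.
  apply/compatP => y; rewrite -!colour_ins // -ins_partner_old.
  by have := H (ins_point y); rewrite ffunE.
rewrite ffunE; case: (ins_partnerP x) => [y||]; rewrite ?colour_ins //.
  by rewrite /colour cE e.
by rewrite /colour cE e.
Qed.

End InsertCup.

Lemma compat_id n g f : size g = n -> size f = n ->
  compat (id_diagram n) g f = (g == f).
Proof.
move=> sg sf; apply/compatP/eqP => [H|-> [i|i]]; try by rewrite ffunE.
apply: (@eq_from_nth _ false) => [|i]; rewrite sg ?sf // => ig.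
by have := H (inr (Ordinal ig)); rewrite ffunE.
Qed.

Lemma compat_cup x y : compat cup_diagram [::] [:: x; y] = (x == y).
Proof.
apply/compatP/eqP => [H|-> [[]|j] //]; rewrite ?ffunE //=.
  by have := H (inr ord_max); rewrite ffunE.
by case: j => [[|[|]]].
Qed.

Lemma colour_l m1 m2 n1 n2 g1 g2 f1 f2 (x : bpoint m1 n1) :
  size g1 = m1 -> size f1 = n1 ->
  colour (g1 ++ g2) (f1 ++ f2) (lpoint m2 n2 x) = colour g1 f1 x.
Proof. by move=> sg sf; case: x => i /=; rewrite nth_cat ?sg ?sf ltn_ord. Qed.

Lemma colour_r m1 m2 n1 n2 g1 g2 f1 f2 (x : bpoint m2 n2) :
  size g1 = m1 -> size f1 = n1 ->
  colour (g1 ++ g2) (f1 ++ f2) (rpoint m1 n1 x) = colour g2 f2 x.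
Proof.
by move=> sg sf; case: x => i /=; rewrite nth_cat ?sg ?sf ltnNge leq_addr addKn.
Qed.

Lemma compat_juxt m1 m2 n1 n2 (d1 : diagram m1 n1) (d2 : diagram m2 n2)
    g1 g2 f1 f2 : size g1 = m1 -> size f1 = n1 ->
  compat (juxt_diagram d1 d2) (g1 ++ g2) (f1 ++ f2) =
  compat d1 g1 f1 && compat d2 g2 f2.
Proof.
move=> sg sf; apply/compatP/andP => [H|[/compatP H1 /compatP H2] x].
  split; apply/compatP => x.
    have := H (lpoint m2 n2 x).
    by rewrite ffunE /juxt_partner lpointK !colour_l.
  have := H (rpoint m1 n1 x).
  by rewrite ffunE /juxt_partner rpointK !colour_r.
rewrite ffunE /juxt_partner; case: (side_pointP x) => y.
  by rewrite !colour_l.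
by rewrite !colour_r.
Qed.

Lemma compat_flip m n (d : diagram m n) g f :
  compat (flip_diagram d) f g = compat d g f.
Proof.
have cs m' n' g' f' (x : bpoint m' n') :
  colour g' f' x = colour f' g' (swap_point x) by case: x.
apply/compatP/compatP => H x.
  have := H (swap_point x); rewrite ffunE /flip_partner swap_pointK.
  by rewrite cs swap_pointK [in X in _ = X]cs swap_pointK.
rewrite ffunE /flip_partner cs swap_pointK H cs.
by case: x.
Qed.

(** * Colourings of glued diagrams *)

Section GlueColour.
Variables (m n p : nat) (d1 : diagram n p) (d2 : diagram m n).

Definition gcolour (g h f : seq bool) (u : gpoint m n p) : bool :=
  match u with
  | inl (inl i) => nth false g i
  | inl (inr j) => nth false h j
  | inr k => nth false f k
  end.

Lemma gcolourK (phi : gpoint m n p -> bool) :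
  gcolour [tuple phi (inl (inl i)) | i < m] [tuple phi (inl (inr j)) | j < n]
    [tuple phi (inr k) | k < p] =1 phi.
Proof. by case=> [[i|j]|k]; rewrite /gcolour -tnth_nth tnth_mktuple. Qed.

Lemma gcolour_lower g h f x : gcolour g h f (lower_point p x) = colour g h x.
Proof. by case: x. Qed.

Lemma gcolour_upper g h f x : gcolour g h f (upper_point m x) = colour h f x.
Proof. by case: x. Qed.

Lemma gcolour_outer g h f x : gcolour g h f (outer_point n x) = colour g f x.
Proof. by case: x. Qed.

Lemma glued_sym : symmetric (glued d1 d2).
Proof.
suff H u v : glued d1 d2 u v -> glued d1 d2 v u.
  by move=> u v; apply/idP/idP; apply: H.
case/orP=> /existsP[x /andP[/eqP-> /eqP->]]; apply/orP; [left|right].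
  by apply/existsP; exists (d2 x); rewrite partnerK !eqxx.
by apply/existsP; exists (d1 x); rewrite partnerK !eqxx.
Qed.

Lemma glued_connect_sym : connect_sym (glued d1 d2).
Proof. exact: sym_connect_sym glued_sym. Qed.

(** The edges of the glued graph are the strands of the two diagrams, so a set is closed precisely
    when its indicator is constant on all of them. *)
Lemma closed_gcolour (A : {pred gpoint m n p}) g h f :
    (forall u, (u \in A) = gcolour g h f u) ->
  fingraph.closed (glued d1 d2) A <-> compat d2 g h /\ compat d1 h f.
Proof.
move=> AE; split=> [H|[/compatP H2 /compatP H1] u v].
  split; apply/compatP => x.
    have := @H (lower_point p (d2 x)) (lower_point p x).
    rewrite !AE !gcolour_lower; apply; apply/orP; left; apply/existsP.
    by exists (d2 x); rewrite partnerK !eqxx.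
  have := @H (upper_point m (d1 x)) (upper_point m x).
  rewrite !AE !gcolour_upper; apply; apply/orP; right; apply/existsP.
  by exists (d1 x); rewrite partnerK !eqxx.
case/orP=> /existsP[x /andP[/eqP-> /eqP->]]; rewrite !AE.
  by rewrite !gcolour_lower.
by rewrite !gcolour_upper.
Qed.

(** Colourings are constant on components; conversely the indicator of the component of [u] is
    itself a compatible colouring. *)
Lemma connect_gluedP u v :
  reflect (forall (g : m.-tuple bool) (h : n.-tuple bool) (f : p.-tuple bool),
      compat d2 g h -> compat d1 h f -> gcolour g h f u = gcolour g h f v)
    (connect (glued d1 d2) u v).
Proof.
apply: (iffP idP) => [uv g h f H2 H1|H].
  pose A := [pred x | gcolour g h f x].
  have /closed_connect/(_ _ _ uv) : fingraph.closed (glued d1 d2) A.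
    by apply/(@closed_gcolour A g h f).
  by rewrite !inE.
pose phi x := connect (glued d1 d2) u x.
have [H2 H1] := (@closed_gcolour [pred x | phi x] _ _ _
  (fun x => esym (gcolourK phi x))).1 (connect_closed glued_connect_sym u).
have := H _ _ _ H2 H1; rewrite !gcolourK /phi connect0 => <- //.
Qed.

End GlueColour.

(** A colouring that vanishes on the outer points is constant on components and zero on those that
    reach the boundary, so it amounts to a choice of a subset of the closed loops. *)
Lemma closed_loops_count m n p (d1 : diagram n p) (d2 : diagram m n) :
  2 ^ closed_loops d1 d2 =
  #|[set h : n.-tuple bool |
      compat d2 (nseq m false) h && compat d1 h (nseq p false)]|.
Proof.
pose e := glued d1 d2; have eC : connect_sym e := glued_connect_sym d1 d2.
pose a := [pred u | [forall x, ~~ connect e u (outer_point n x)]].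
pose r := [set u in [predI roots e & a]].
have -> : closed_loops d1 d2 = #|r| by rewrite cardsE.
(* [r] contains one root per closed loop; [G s] colours the loops whose root lies in [s]. It maps
   the subsets of [r] bijectively to the counted colourings. *)
pose G (s : {set gpoint m n p}) : n.-tuple bool :=
  [tuple fingraph.root e (inl (inr j)) \in s | j < n].
have nth0 k i : nth false (nseq k false) i = false by rewrite nth_nseq if_same.
have GE (s : {set gpoint m n p}) : s \subset r ->
    forall u, gcolour (nseq m false) (G s) (nseq p false) u =
      (fingraph.root e u \in s).
  move=> sr; have out x : (fingraph.root e (outer_point n x) \in s) = false.
    apply/negP => /(fintype.subsetP sr); rewrite !inE => /andP[_ /forallP/(_ x)].
    by rewrite eC connect_root.
  case=> [[i|j]|k]; rewrite /gcolour ?nth0.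
  - by rewrite (out (inl i)).
  - by rewrite -tnth_nth tnth_mktuple.
  - by rewrite (out (inr k)).
rewrite -card_powerset -(card_in_imset (f := G) (D := powerset r)) => [|s s'].
  apply: eq_card => h; rewrite !inE; apply/imsetP/andP => [[s]|[H2 H1]].
    rewrite powersetE => sr ->; apply/(@closed_gcolour _ _ _ d1 d2
      [pred u | fingraph.root e u \in s]) => [u|u v uv] /=; first by rewrite GE.
    by rewrite !inE (fingraph.rootP eC (connect1 uv)).
  pose phi (u : gpoint m n p) := gcolour (nseq m false) h (nseq p false) u.
  have phiC u v : connect e u v -> phi u = phi v.
    move/closed_connect; apply; apply/(@closed_gcolour _ _ _ d1 d2
      [pred u | phi u] _ h _ (fun _ => erefl)); by split.
  exists [set u in r | phi u].
    by rewrite powersetE; apply/fintype.subsetP => u; rewrite inE => /andP[].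
  apply: eq_from_tnth => j; rewrite tnth_mktuple !inE roots_root //=.
  rewrite -(phiC _ _ (connect_root e _)) /phi /= -tnth_nth.
  apply/idP/andP => [hj|[]//]; split=> //; apply/forallP => x; apply/negP => cx.
  have := phiC _ _ (connect_trans (connect_root e (inl (inr j))) cx).
  by rewrite /phi gcolour_outer /= -tnth_nth hj; case: x {cx} => i /=; rewrite nth0.
rewrite !powersetE => sr sr' ss'; apply/setP => u.
have [ur|ur] := boolP (u \in r).
  have /eqP ru : fingraph.root e u == u by move: ur; rewrite !inE => /andP[].
  by rewrite -ru -!GE // ss'.
by apply/idP/idP => us; case/negP: ur;
  [apply: (fintype.subsetP sr) | apply: (fintype.subsetP sr')].
Qed.

(** * Composition in terms of colourings *)

Section Rec.
Local Open Scope ring_scope.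
Variable R : realType.
Local Notation C := R[i].
Implicit Types delta : C.

Lemma rscaleE m n (c : C) (x : Rec R m n) d : (c *: x) d = c * x d.
Proof. by rewrite ffunE. Qed.

Lemma raddE m n (x y : Rec R m n) d : (x + y) d = x d + y d.
Proof. by rewrite ffunE. Qed.

Lemma rcomp_linearl delta m n p (c : C) (x x' : Rec R n p) (y : Rec R m n) :
  rcomp delta (c *: x + x') y = c *: rcomp delta x y + rcomp delta x' y.
Proof.
apply/ffunP => d; rewrite raddE rscaleE 3!ffunE mulr_sumr -big_split.
apply: eq_bigr => d1 _ /=; rewrite mulr_sumr -big_split; apply: eq_bigr => d2 _ /=.
by rewrite raddE rscaleE !mulrDl !mulrA.
Qed.

Lemma rcomp_linearr delta m n p (c : C) (x : Rec R n p) (y y' : Rec R m n) :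
  rcomp delta x (c *: y + y') = c *: rcomp delta x y + rcomp delta x y'.
Proof.
apply/ffunP => d; rewrite raddE rscaleE 3!ffunE mulr_sumr -big_split.
apply: eq_bigr => d1 _ /=; rewrite mulr_sumr -big_split; apply: eq_bigr => d2 _ /=.
by rewrite raddE rscaleE mulrDr mulrDl mulrCA -!mulrA.
Qed.

Lemma rcomp0l delta m n p (y : Rec R m n) :
  rcomp delta (0 : Rec R n p) y = 0.
Proof.
by have := rcomp_linearl delta (-1) (0 : Rec R n p) 0 y;
  rewrite scaler0 addr0 scaleN1r addNr.
Qed.

Lemma rcomp0r delta m n p (x : Rec R n p) :
  rcomp delta x (0 : Rec R m n) = 0.
Proof.
by have := rcomp_linearr delta (-1) x (0 : Rec R m n) 0;
  rewrite scaler0 addr0 scaleN1r addNr.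
Qed.

Lemma rcomp_suml delta m n p I (r : seq I) (c : I -> C) (x : I -> Rec R n p)
    (y : Rec R m n) :
  rcomp delta (\sum_(i <- r) c i *: x i) y =
  \sum_(i <- r) c i *: rcomp delta (x i) y.
Proof.
elim: r => [|i r IH]; first by rewrite !big_nil rcomp0l.
by rewrite !big_cons rcomp_linearl IH.
Qed.

Lemma rcomp_sumr delta m n p I (r : seq I) (c : I -> C) (x : Rec R n p)
    (y : I -> Rec R m n) :
  rcomp delta x (\sum_(i <- r) c i *: y i) =
  \sum_(i <- r) c i *: rcomp delta x (y i).
Proof.
elim: r => [|i r IH]; first by rewrite !big_nil rcomp0r.
by rewrite !big_cons rcomp_linearr IH.
Qed.

Lemma rcomp_dbasis delta m n p (d1 : diagram n p) (d2 : diagram m n) d :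
  rcomp delta (dbasis R d1) (dbasis R d2) d =
  (is_composite d1 d2 d)%:R * delta ^+ closed_loops d1 d2.
Proof.
rewrite ffunE (bigD1 d1) //= [X in _ + X]big1 ?addr0 => [|d1' dd1].
  rewrite big_mkcond (bigD1 d2) //= [X in _ + X]big1 ?addr0 => [|d2' dd2].
    by rewrite !ffunE !eqxx !mul1r; case: ifP; rewrite ?mul1r ?mul0r.
  by rewrite !ffunE (negbTE dd2) mulr0 mul0r if_same.
by apply: big1 => d2' _; rewrite !ffunE (negbTE dd1) !mul0r.
Qed.

Lemma is_compositeP m n p (d1 : diagram n p) (d2 : diagram m n) d :
  reflect (forall (g : m.-tuple bool) (h : n.-tuple bool) (f : p.-tuple bool),
      compat d2 g h -> compat d1 h f -> compat d g f)
    (is_composite d1 d2 d).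
Proof.
apply: (iffP forallP) => [H g h f H2 H1|H x].
  apply/compatP => x.
  by rewrite -!(@gcolour_outer m n p g h f); apply/esym/(connect_gluedP _ _ _ _ (H x)).
apply/connect_gluedP => g h f H2 H1; rewrite !gcolour_outer.
by have /compatP -> := H g h f H2 H1.
Qed.

(** Since the top colouring determines the middle one, only the zero colouring extends zero: there
    are no closed loops and the coefficient is 1. The diagram is unique by [compat_inj]. *)
Lemma rcomp_dbasis_unique delta m n p (d1 : diagram n p) (d2 : diagram m n) d :
    (forall (g : m.-tuple bool) (f : p.-tuple bool), compat d g f <->
      exists2 h : n.-tuple bool, compat d2 g h & compat d1 h f) ->
    (forall (h h' : n.-tuple bool) (f : p.-tuple bool),
      compat d1 h f -> compat d1 h' f -> h = h') ->
  rcomp delta (dbasis R d1) (dbasis R d2) = dbasis R d.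
Proof.
move=> Hd Hu; have l0 : closed_loops d1 d2 = 0%N.
  apply/eqP; rewrite -(eqn_exp2l (m := 2)) // closed_loops_count.
  have cf k l (d' : diagram k l) : compat d' (nseq k false) (nseq l false).
    by apply/compatP; have nth0 j i : nth false (nseq j false) i = false;
      [rewrite nth_nseq if_same | move=> x; case: (d' x); case: x => i j /=;
       rewrite !nth0].
  apply/eqP; apply: (@fintype.eq_card1 _ [tuple of nseq n false]) => h; rewrite !inE.
  apply/andP/eqP => [[_ H1]|->]; last by split; apply: cf.
  by apply: (Hu _ _ [tuple of nseq p false] H1); apply: cf.
apply/ffunP => d'; rewrite rcomp_dbasis l0 mulr1 ffunE; congr (nat_of_bool _)%:R.
apply/is_compositeP/eqP => [H|-> g h f H2 H1]; last by apply/Hd; exists h.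
by apply/esym/compat_inj => g f /Hd[h H2 H1]; apply: H H1.
Qed.

(** * Diagrams represented by words *)

Definition represents m n (d : diagram m n) (w : seq nat) : bool :=
  [forall g : m.-tuple bool, forall f : n.-tuple bool,
    compat d g f == (reduce w f == Some (val g))].

Lemma representsP m n (d : diagram m n) w :
  reflect (forall g f, size g = m -> size f = n ->
      compat d g f = (reduce w f == Some g))
    (represents d w).
Proof.
apply: (iffP forallP) => [H g f sg sf|H g]; last first.
  by apply/forallP => f; rewrite H ?size_tuple.
move: sg sf => /eqP sg /eqP sf.
by have /forallP/(_ (Tuple sf))/eqP := H (Tuple sg).
Qed.

Lemma represents_inj m n (d d' : diagram m n) w :
  represents d w -> represents d' w -> d = d'.
Proof.
move=> /representsP H /representsP H'; apply: compat_inj => g f.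
by rewrite H ?H' ?size_tuple.
Qed.

(** Induction from the end of the word, because the last letter is the topmost cup and [insert_cup]
    adds cups at the top. *)
Lemma represents_exists m n w : valid m w -> n = (m + (size w).*2)%N ->
  exists d : diagram m n, represents d w.
Proof.
elim/last_ind: w n => [|w c IH] n.
  move=> _; rewrite addn0 => ->; exists (id_diagram m).
  by apply/representsP => g f sg sf; rewrite compat_id //= eq_sym.
rewrite valid_rcons size_rcons doubleS !addnS => /andP[vw cm] ->.
have [d /representsP dw] := IH _ vw erefl.
have cm' : (c < (m + (size w).*2).+1)%N by [].
exists (insert_cup d (Ordinal cm')); apply/representsP => g f sg sf.
rewrite compat_insert //= -cats1 reduce_cat /= /remove_pair; case: eqP => //= e.
rewrite dw // size_cat size_drop size_takel sf; first by lia.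
exact: leq_trans cm (leqW (leqnSn _)).
Qed.

(** Written as an indicator, so that [m] and [n] are free parameters and casts act trivially; it is
    zero if no diagram represents [w]. *)
Definition rword m n (w : seq nat) : Rec R m n :=
  [ffun d => (represents d w)%:R].

Lemma rwordE m n (d : diagram m n) w : represents d w ->
  rword m n w = dbasis R d.
Proof.
move=> dw; apply/ffunP => d'; rewrite !ffunE; congr (nat_of_bool _)%:R.
by apply/idP/eqP => [d'w|->//]; apply: represents_inj d'w dw.
Qed.

Lemma rcast_rword m n m' n' (e : (m = m') * (n = n')) w :
  rcast e (rword m n w) = rword m' n' w.
Proof. by case: e => e1 e2; case: _ / e1; case: _ / e2. Qed.

Lemma rcomp_rword delta m n c w : valid m (c :: w) ->
    n = (m.+2 + (size w).*2)%N ->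
  rcomp delta (rword m.+2 n w) (rword m m.+2 [:: c]) = rword m n (c :: w).
Proof.
move=> vcw en; have [d dcw] : exists d : diagram m n, represents d (c :: w).
  by apply: represents_exists; rewrite // en /= doubleS !addnS.
move: (vcw) => /= /andP[cm vw].
have [d1 d1w] := represents_exists vw en.
have [d2 d2c] : exists d : diagram m m.+2, represents d [:: c].
  by apply: represents_exists; rewrite /= ?cm // addn2.
rewrite (rwordE dcw) (rwordE d1w) (rwordE d2c).
move: dcw d1w d2c => /representsP dcw /representsP d1w /representsP d2c.
apply: rcomp_dbasis_unique => [g f|h h' f]; last first.
  by rewrite !d1w ?size_tuple // => /eqP-> /eqP[] /val_inj.
rewrite dcw ?size_tuple //= -/(reduce w f); split=> [|[h]]; last first.
  by rewrite d2c ?d1w ?size_tuple // => /eqP hg /eqP ->; apply/eqP.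
case E: (reduce w f) => [h|//] hg.
have sh : size h == m.+2 by rewrite (size_reduce vw _ E) // size_tuple.
by exists (Tuple sh); rewrite ?d2c ?d1w ?size_tuple // ?E.
Qed.

Lemma rdagger_dbasis m n (d : diagram m n) :
  rdagger (dbasis R d) = dbasis R (flip_diagram d).
Proof.
have flipK k l (d' : diagram k l) : flip_diagram (flip_diagram d') = d'.
  by apply: compat_inj => g f; rewrite !compat_flip.
apply/ffunP => d'; rewrite !ffunE.
rewrite (can2_eq (flipK _ _) (flipK _ _)).
by case: eqP; rewrite ?rmorph1 ?rmorph0.
Qed.

(** The diagram of [w] below the reflected diagram of [w'] consists of one through strand and [l]
    closed loops, and [closed_loops_count] gives [2 ^ l] as a count of bit sequences. *)
Lemma rdot_rword delta n w w' : valid 1 w -> valid 1 w' ->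
    n = (1 + (size w).*2)%N -> n = (1 + (size w').*2)%N ->
  exists2 l, closed_count n w w' = (2 ^ l)%N &
    rdot delta (rword 1 n w) (rword 1 n w') = delta ^+ l.
Proof.
move=> vw vw' nw nw'; have [d dw] := represents_exists vw nw.
have [d' dw'] := represents_exists vw' nw'.
exists (closed_loops (flip_diagram d') d).
  rewrite closed_loops_count /closed_count -count_bitseqs_tuple.
  apply: eq_card => f; rewrite !inE compat_flip.
  move: dw dw' => /representsP dw /representsP dw'.
  by rewrite dw ?dw' ?size_tuple.
rewrite /rdot (rwordE dw) (rwordE dw') rdagger_dbasis rcomp_dbasis.
rewrite (_ : is_composite _ _ _) ?mul1r //; apply/is_compositeP => g h f.
move: dw dw' => /representsP dw /representsP dw'.
rewrite compat_flip dw ?dw' ?size_tuple // => /eqP hg /eqP hf.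
rewrite compat_id ?size_tuple //.
(* Both ends of the through strand have the parity of [h] as their colour. *)
have := parity_reduce vw _ hg; rewrite -(parity_reduce vw' _ hf) ?size_tuple // => e.
move: e; case: (tupleP g) (tupleP f) => x g' [y f'].
rewrite (tuple0 g') (tuple0 f') /parity /= => /(_ nw).
by case: x y => -[].
Qed.

End Rec.

(** * Images of forests *)

Lemma represents_cup : represents cup_diagram [:: 0].
Proof.
apply/representsP => g [|x [|y []]] // /size0nil -> _.
by rewrite compat_cup /= /remove_pair /=; case: eqP.
Qed.

Lemma represents_idl k m n (d : diagram m n) w :
  represents d w -> represents (juxt_diagram (id_diagram k) d) (map (addn k) w).
Proof.
move=> /representsP dw; apply/representsP => g f sg sf.
rewrite -(cat_take_drop k g) -(cat_take_drop k f).
have sg1 : size (take k g) = k by rewrite size_takel // sg leq_addr.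
have sf1 : size (take k f) = k by rewrite size_takel // sf leq_addr.
rewrite compat_juxt // compat_id // dw ?size_drop ?sg ?sf ?addKn //.
have := reduce_shift w (take k f) (drop k f); rewrite sf1 => ->.
case: (reduce w _) => [h|] /=; last by rewrite andbF.
by rewrite -[RHS]/(_ ++ _ == _ ++ _) eqseq_cat ?sf1 // eq_sym.
Qed.

Lemma represents_idr k m n (d : diagram m n) c : c.+1 < n -> n = m.+2 ->
  represents d [:: c] -> represents (juxt_diagram d (id_diagram k)) [:: c].
Proof.
move=> cn nm /representsP dc; apply/representsP => g f sg sf.
rewrite -(cat_take_drop m g) -(cat_take_drop n f).
have sg1 : size (take m g) = m by rewrite size_takel // sg leq_addr.
have sf1 : size (take n f) = n by rewrite size_takel // sf leq_addr.
rewrite compat_juxt // compat_id ?size_drop ?sg ?sf ?addKn // dc //.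
have rmE f2 : remove_pair c (take n f ++ f2) =
    omap (cat^~ f2) (remove_pair c (take n f)).
  rewrite /remove_pair !nth_cat sf1 cn (ltnW cn); case: eqP => //= _; congr Some.
  rewrite take_cat drop_cat sf1 (ltnW cn); case: ltnP => nc; first by rewrite catA.
  have -> : n = c.+2 by apply/eqP; rewrite eqn_leq nc.
  rewrite subnn drop0 [drop c.+2 (take _ _)]drop_oversize ?cats0 //.
  by rewrite size_take_min geq_minl.
rewrite /= rmE; case E: (remove_pair c _) => [h|] //=.
have sh : size h = m.
  by have := size_remove_pair _ E; rewrite sf1 => /(_ cn); rewrite nm => -[].
by rewrite -[RHS]/(_ ++ _ == _ ++ _) eqseq_cat ?sh // [X in _ && X]eq_sym.
Qed.

Section Rec.
Local Open Scope ring_scope.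
Variable R : realType.
Local Notation C := R[i].

Lemma rjuxt_dbasis m1 m2 n1 n2 (d1 : diagram m1 n1) (d2 : diagram m2 n2) :
  rjuxt (dbasis R d1) (dbasis R d2) = dbasis R (juxt_diagram d1 d2).
Proof.
rewrite /rjuxt (bigD1 d1) //= [X in _ + X]big1 ?addr0 => [|d1' dd1].
  rewrite (bigD1 d2) //= [X in _ + X]big1 ?addr0 => [|d2' dd2].
    by rewrite !ffunE !eqxx mulr1 scale1r.
  by rewrite !ffunE (negbTE dd2) mulr0 scale0r.
by apply: big1 => d2' _; rewrite !ffunE (negbTE dd1) mul0r scale0r.
Qed.

Lemma rjuxt_linearl m1 m2 n1 n2 (c c' : C) (x x' : Rec R m1 n1)
    (y : Rec R m2 n2) :
  rjuxt (c *: x + c' *: x') y = c *: rjuxt x y + c' *: rjuxt x' y.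
Proof.
rewrite /rjuxt !scaler_sumr -big_split; apply: eq_bigr => d1 _ /=.
rewrite !scaler_sumr -big_split; apply: eq_bigr => d2 _ /=.
by rewrite raddE !rscaleE mulrDl scalerDl !scalerA !mulrA.
Qed.

Lemma rjuxt_linearr m1 m2 n1 n2 (c c' : C) (x : Rec R m1 n1)
    (y y' : Rec R m2 n2) :
  rjuxt x (c *: y + c' *: y') = c *: rjuxt x y + c' *: rjuxt x y'.
Proof.
rewrite /rjuxt !scaler_sumr -big_split; apply: eq_bigr => d1 _ /=.
rewrite !scaler_sumr -big_split; apply: eq_bigr => d2 _ /=.
by rewrite raddE !rscaleE mulrDr scalerDl !scalerA !(mulrCA (x d1)).
Qed.

Lemma rcast_linear m n m' n' (e : (m = m') * (n = n')) (c c' : C)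
    (x y : Rec R m n) :
  rcast e (c *: x + c' *: y) = c *: rcast e x + c' *: rcast e y.
Proof. by case: e => e1 e2; case: _ / e1; case: _ / e2. Qed.

Lemma rcast_sum m n m' n' (e : (m = m') * (n = n')) I (r : seq I) (c : I -> C)
    (x : I -> Rec R m n) :
  rcast e (\sum_(i <- r) c i *: x i) = \sum_(i <- r) c i *: rcast e (x i).
Proof. by case: e => e1 e2; case: _ / e1; case: _ / e2. Qed.

Section Words.
Variables (a b delta : C).

(** Root [i] is the strand [i.*2]. The coefficient [a] belongs to a cup on its right, at an odd
    position, and [b] to a cup on its left, at an even one; hence [weight] can be read off the
    parities of the letters. *)
Lemma Phi_caret_rword n (i : 'I_n) :
  Phi_caret a b i = a *: rword R (strands n) (strands n.+1) [:: i.*2.+1] +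
    b *: rword R (strands n) (strands n.+1) [:: i.*2].
Proof.
rewrite /Phi_caret /rho /rid /rcup !rjuxt_dbasis rjuxt_linearr rjuxt_linearl.
rewrite !rjuxt_dbasis rcast_linear.
have dr := represents_idl 1 represents_cup.
have dl := represents_idr 1 (ltnSn 1) erefl represents_cup.
have Dr : represents (juxt_diagram (juxt_diagram (id_diagram i.*2)
    (juxt_diagram (id_diagram 1) cup_diagram)) (id_diagram (n - i.+1).*2))
    [:: i.*2.+1].
  rewrite (_ : [:: i.*2.+1] = map (addn i.*2) [:: 1%N]) /= ?addn1 //.
  apply: represents_idr (represents_idl i.*2 dr); lia.
have Dl : represents (juxt_diagram (juxt_diagram (id_diagram i.*2)
    (juxt_diagram cup_diagram (id_diagram 1))) (id_diagram (n - i.+1).*2))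
    [:: i.*2].
  rewrite (_ : [:: i.*2] = map (addn i.*2) [:: 0%N]); last by rewrite /= addn0.
  apply: represents_idr (represents_idl i.*2 dl); lia.
rewrite -(rwordE R Dr) -(rwordE R Dl).
by congr (_ *: _ + _ *: _); apply: rcast_rword.
Qed.

(** This follows the recursion of [Phi_rec], each branching offering the choice between its two
    cups. *)
Fixpoint forest_words (k : nat) (f : seq btree) : seq (seq nat) :=
  if k is k'.+1 then
    let i := find is_node f in
    let ws := forest_words k' (prune f) in
    map (cons i.*2.+1) ws ++ map (cons i.*2) ws
  else [:: [::]].

Definition weight (w : seq nat) : C := \prod_(c <- w) (if odd c then a else b).

Lemma size_prune f : has is_node f -> size (prune f) = (size f).+1.
Proof. by elim: f => //= -[|l r] f IH //= /IH ->. Qed.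

Lemma nodes_prune f : has is_node f -> nodes f = (nodes (prune f)).+1.
Proof.
elim: f => //= -[|l r] f IH /=; rewrite /nodes /=.
  by move=> /IH; rewrite /nodes /=.
by rewrite addnA.
Qed.

Lemma nodes_gt0 f : (0 < nodes f)%N = has is_node f.
Proof. by elim: f => //= -[|l r] f IH. Qed.

Lemma has_node k f : nodes f = k.+1 -> has is_node f.
Proof. by rewrite -nodes_gt0 => ->. Qed.

Lemma forest_words_size k f w : w \in forest_words k f -> size w = k.
Proof.
elim: k f w => [|k IH] f w /=; first by rewrite inE => /eqP ->.
by rewrite mem_cat => /orP[] /mapP[w' /IH <- ->].
Qed.

Lemma forest_words_valid k f w : nodes f = k -> (0 < size f)%N ->
  w \in forest_words k f -> valid (strands (size f)) w.
Proof.
elim: k f w => [|k IH] f w /=; first by rewrite inE => _ _ /eqP ->.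
move=> /[dup] nf /has_node hf sf; move: (hf); rewrite has_find => fs.
have E : strands (size (prune f)) = (strands (size f)).+2.
  by rewrite size_prune // /strands; lia.
have nf' : nodes (prune f) = k by move: nf; rewrite nodes_prune // => -[].
have H w' : w' \in forest_words k (prune f) -> valid (strands (size f)).+2 w'.
  by move=> /(IH _ _ nf'); rewrite E size_prune //; apply.
by rewrite mem_cat => /orP[] /mapP[w' /H v ->] /=; rewrite v andbT /strands; lia.
Qed.

Lemma Phi_rec_words k n f : size f = n -> (0 < n)%N -> nodes f = k ->
  Phi_rec a b delta k n f =
  \sum_(w <- forest_words k f)
    weight w *: rword R (strands n) (strands (NatTrec.add k n)) w.
Proof.
elim: k n f => [|k IH] n f sf n0 nf.
  rewrite /= big_seq1 /weight big_nil scale1r; apply/esym/rwordE.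
  by apply/representsP => g h sg sh; rewrite compat_id // eq_sym.
have hf := has_node nf; move: (hf); rewrite has_find sf => fs.
have nf' : nodes (prune f) = k by move: nf; rewrite nodes_prune // => -[].
have sE : strands n.+1 = (strands n).+2 by rewrite /strands; lia.
rewrite [LHS]/= insubT /= (IH n.+1) ?size_prune ?sf // Phi_caret_rword.
rewrite rcomp_suml big_cat !big_map /= -big_split /=.
rewrite [LHS]big_seq [RHS]big_seq; apply: eq_bigr => w wf.
have vw := forest_words_valid nf' _ wf; have sw := forest_words_size wf.
rewrite size_prune // sf sE in vw.
rewrite -[b *: _]addr0 !rcomp_linearr rcomp0r addr0 !sE !rcomp_rword.
- rewrite /weight !big_cons /= odd_double scalerDr !scalerA.
  by rewrite !(mulrC (\prod_(_ <- _) _)).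
- by rewrite /= vw // andbT /strands; lia.
- by rewrite sw NatTrec.addE /strands; lia.
- by rewrite /= vw // andbT /strands; lia.
- by rewrite sw NatTrec.addE /strands; lia.
Qed.

Lemma Phi_words n m (f : forest n m) : (0 < n)%N ->
  Phi a b delta f = \sum_(w <- forest_words (nodes f) f)
    weight w *: rword R (strands n) (strands m) w.
Proof.
move=> n0; rewrite /Phi Phi_rec_words ?size_forest // rcast_sum.
by apply: eq_bigr => w _; rewrite rcast_rword.
Qed.

End Words.
End Rec.

(** * Grafting a tree on the last leaf *)

Fixpoint graft_last (v t : btree) : btree :=
  if t is Node l r then Node l (graft_last v r) else v.

Fixpoint stack_last (v : btree) (f : seq btree) : seq btree :=
  match f with
  | [::] => [::]
  | [:: t] => [:: graft_last v t]
  | t :: f' => t :: stack_last v f'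
  end.

Lemma stack_last_cons v t f : 0 < size f ->
  stack_last v (t :: f) = t :: stack_last v f.
Proof. by case: f. Qed.

Lemma graft_leaves t : graft t (nseq (tleaves t) Leaf) = t.
Proof.
elim: t => //= l IHl r IHr.
by rewrite nseqD take_size_cat ?drop_size_cat ?size_nseq // IHl IHr.
Qed.

Lemma tleaves_gt0 t : 0 < tleaves t.
Proof. by elim: t => //= l IHl r IHr; rewrite addn_gt0 IHl. Qed.

Lemma graft_lastE v t :
  graft t (rcons (nseq (tleaves t).-1 Leaf) v) = graft_last v t.
Proof.
elim: t => //= l IHl r IHr; have r0 := tleaves_gt0 r.
have -> : (tleaves l + tleaves r).-1 = tleaves l + (tleaves r).-1 by lia.
rewrite nseqD rcons_cat take_size_cat ?drop_size_cat ?size_nseq //.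
by rewrite graft_leaves IHr.
Qed.

Lemma find_stack_last v f : has is_node f ->
  find is_node (stack_last v f) = find is_node f.
Proof.
elim: f => //= -[|l r] f IH hf; last by case: f {IH hf}.
have f0 : 0 < size f by case: f hf {IH}.
by rewrite -/(stack_last v (Leaf :: f)) stack_last_cons //= IH.
Qed.

(** The branching taken away is one of [f], so [v] stays on the last leaf. *)
Lemma prune_stack_last v f : has is_node f ->
  prune (stack_last v f) = stack_last v (prune f).
Proof.
elim: f => //= -[|l r] f IH hf; last by case: f {IH hf}.
have f0 : 0 < size f by case: f hf {IH}.
rewrite -/(stack_last v (Leaf :: f)) stack_last_cons //= IH //.
by rewrite -[RHS]/(stack_last v (_ :: _)) stack_last_cons // size_prune.
Qed.

Lemma forest_words_leaf k f :
  forest_words k (Leaf :: f) = map (map (addn 2)) (forest_words k f).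
Proof.
elim: k f => //= k IH f; rewrite map_cat -!map_comp IH -!map_comp.
by congr (_ ++ _); apply: eq_map.
Qed.

Lemma forest_words_leaves k j f :
  forest_words k (nseq j Leaf ++ f) = map (map (addn j.*2)) (forest_words k f).
Proof.
elim: j => [|j IH].
  rewrite /= -[LHS]map_id; apply: eq_map => w; rewrite -[LHS]map_id.
  exact: eq_map.
rewrite /= forest_words_leaf IH -map_comp; apply: eq_map => w /=.
by rewrite -map_comp; apply: eq_map => c /=; rewrite doubleS.
Qed.

Lemma no_nodes f : nodes f = 0 -> f = nseq (size f) Leaf.
Proof. by elim: f => //= -[|l r] f IH //= /IH <-. Qed.

(** All branchings of [f] are taken away before those of [v]. What remains is a row of leaves ending
    in [v], whose root is the strand [(leaves f).-1.*2]. *)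
Lemma forest_words_stack_last v k f : nodes f = k -> 0 < size f ->
  forest_words (k + tnodes v) (stack_last v f) =
  [seq w ++ map (addn (leaves f).-1.*2) e
    | w <- forest_words k f, e <- forest_words (tnodes v) [:: v]].
Proof.
elim: k f => [|k IH] f nf f0.
  rewrite (no_nodes nf) leaves_nseq add0n; case: (size f) f0 => // n _ /=.
  rewrite cats0 -forest_words_leaves; congr forest_words.
  elim: n => //= n IH.
  by rewrite -[LHS]/(stack_last v (_ :: _ :: _)) stack_last_cons // -IH.
have hf := has_node nf; rewrite addSn /= find_stack_last // prune_stack_last //.
have nf' : nodes (prune f) = k by move: nf; rewrite nodes_prune // => -[].
have lf : leaves (prune f) = leaves f.
  by rewrite !leavesE size_prune // nf nf' addSnnS.
rewrite IH ?size_prune // lf allpairs_cat !allpairs_mapl.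
by rewrite !map_allpairs.
Qed.

Lemma last_forest_subproof v n :
  (size (rcons (nseq n Leaf) v) == n.+1) &&
  (leaves (rcons (nseq n Leaf) v) == tleaves v + n).
Proof.
rewrite size_rcons size_nseq eqxx -cats1 leaves_cat leaves_nseq /=.
by rewrite /leaves /= addn0 addnC.
Qed.

Definition last_forest v n : forest n.+1 (tleaves v + n) :=
  Forest (last_forest_subproof v n).

Lemma forest_words_last v n (s : tree n.+1) :
  let q := last_forest v n \oF s in
  forest_words (nodes q) q =
  [seq w ++ map (addn n.*2) e
    | w <- forest_words (nodes s) s, e <- forest_words (tnodes v) [:: v]].
Proof.
move=> q; have qE : trees q = stack_last v s.
  case: s @q => [[|t [|]] //= st]; have tn : tleaves t = n.+1.
    by move: st; rewrite leaves_cons addn0 => /eqP.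
  by rewrite -graft_lastE tn take_oversize // size_rcons size_nseq.
have nq : nodes q = nodes s + tnodes v.
  have := leavesE q; have := leavesE s; rewrite !leaves_forest !size_forest.
  have := leavesE [:: v]; rewrite /leaves /nodes /= !addn0 => ->; lia.
rewrite nq qE forest_words_stack_last ?size_forest //.
by rewrite leaves_forest.
Qed.

(** * The pairing coefficient *)

Section Coefficient.
Local Open Scope ring_scope.
Variable R : realType.
Local Notation C := R[i].
Variables a b delta : C.

Lemma rdagger_antilinear m n (c c' : C) (x y : Rec R m n) : c' = c^* ->
  rdagger (c *: x + y) = c' *: rdagger x + rdagger y.
Proof.
have dE (z : Rec R m n) d : rdagger z d = (z (flip_diagram d))^* by rewrite ffunE.
move=> ->; apply/ffunP => d; rewrite raddE rscaleE !dE raddE rscaleE.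
by rewrite rmorphD rmorphM.
Qed.

Lemma rdagger_sum m n I (r : seq I) (c c' : I -> C) (x : I -> Rec R m n) :
    (forall i, c' i = (c i)^*) ->
  rdagger (\sum_(i <- r) c i *: x i) = \sum_(i <- r) c' i *: rdagger (x i).
Proof.
move=> cE; elim: r => [|i r IH].
  by rewrite !big_nil; apply/ffunP => d; rewrite !ffunE rmorph0.
by rewrite !big_cons (rdagger_antilinear _ _ (cE i)) IH.
Qed.

Lemma rdot_sum n I J (r : seq I) (s : seq J) (c : I -> C) (c' : J -> C)
    (x : I -> Rec R 1 n) (y : J -> Rec R 1 n) :
  rdot delta (\sum_(i <- r) c i *: x i) (\sum_(j <- s) c' j *: y j) =
  \sum_(i <- r) \sum_(j <- s) c i * (c' j)^* * rdot delta (x i) (y j).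
Proof.
rewrite /rdot (rdagger_sum _ _ (fun=> erefl)) rcomp_sumr sum_ffunE.
apply: eq_bigr => i _; rewrite rscaleE rcomp_suml sum_ffunE mulr_sumr; apply: eq_bigr => j _.
by rewrite rscaleE mulrA.
Qed.

(** The exponent is read off one bit; [rdot_Phi_last] checks by computation that both bits give
    exactly this power of two. *)
Definition local_loops (e e' : seq nat) : nat :=
  trunc_log 2 (local_count true e e').

Lemma rdot_rword_extend n w w' e e' :
    size w = n -> size w' = n -> valid 1 w -> valid 1 w' ->
    size e = 2 -> size e' = 2 -> valid 1 e -> valid 1 e' ->
    (forall t, local_count t e e' = 2 ^ local_loops e e')%N ->
  rdot delta (rword R 1 (n.*2 + 5) (w ++ map (addn n.*2) e))
    (rword R 1 (n.*2 + 5) (w' ++ map (addn n.*2) e')) =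
  delta ^+ local_loops e e' *
    rdot delta (rword R 1 (n.*2 + 1) w) (rword R 1 (n.*2 + 1) w').
Proof.
move=> sw sw' vw vw' se se' ve ve' le.
have valid_ext u d : size u = n -> size d = 2 -> valid 1 u -> valid 1 d ->
    valid 1 (u ++ map (addn n.*2) d).
  move=> <- {se se' sw sw'}; case: d => [|d1 [|d2 []]] // _ vu /=.
  rewrite -cat_rcons cats1 !valid_rcons vu size_rcons /=; lia.
have [l0 cl0 ->] := rdot_rword delta vw vw' (n := (n.*2 + 1)%N)
  ltac:(by rewrite sw addnC) ltac:(by rewrite sw' addnC).
have [l1 cl1 ->] := rdot_rword delta (valid_ext _ _ sw se vw ve)
  (valid_ext _ _ sw' se' vw' ve') (n := (n.*2 + 5)%N)
  ltac:(by rewrite size_cat size_map sw se; lia)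
  ltac:(by rewrite size_cat size_map sw' se'; lia).
(* Loop numbers are compared through the powers of two that count colourings. *)
rewrite -exprD; congr (_ ^+ _); apply/eqP.
rewrite -(eqn_exp2l (m := 2)) // expnD -cl0 -cl1.
by rewrite (closed_count_extend _ _ _ _ _ _ _ le).
Qed.

Let caretl := Node (Node Leaf Leaf) Leaf.
Let caretr := Node Leaf (Node Leaf Leaf).

Hypotheses (aR : a^* = a) (bR : b^* = b).
Hypothesis norm1 : delta * (a ^+ 2 + b ^+ 2) + 2 * a * b = 1.

Definition coefficient : C := 1 - a ^+ 2 * b ^+ 2 * (delta ^+ 2 - 1).

Lemma weight_cat w e : weight a b (w ++ e) = weight a b w * weight a b e.
Proof. exact: big_cat. Qed.

Lemma weight_shift n e : weight a b (map (addn n.*2) e) = weight a b e.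
Proof.
by rewrite /weight big_map; apply: eq_bigr => c _; rewrite oddD odd_double.
Qed.

Lemma weight_real w : (weight a b w)^* = weight a b w.
Proof.
rewrite /weight rmorph_prod; apply: eq_bigr => c _.
by case: odd; rewrite ?aR ?bR.
Qed.

Lemma local_sum :
  \sum_(e <- forest_words 2 [:: caretl]) \sum_(e' <- forest_words 2 [:: caretr])
    weight a b e * weight a b e' * delta ^+ local_loops e e' = coefficient.
Proof.
have -> : forest_words 2 [:: caretl] =
  [:: [:: 1; 1]; [:: 1; 0]; [:: 0; 1]; [:: 0; 0]]%N by [].
have -> : forest_words 2 [:: caretr] =
  [:: [:: 1; 3]; [:: 1; 2]; [:: 0; 3]; [:: 0; 2]]%N by [].
rewrite !big_cons !big_nil /weight !big_cons !big_nil /=.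
repeat match goal with |- context [local_loops ?x ?y] =>
  let l := eval vm_compute in (local_loops x y) in
  change (local_loops x y) with l end.
(* Before normalization the sixteen terms add up to the square of the normalized quantity minus the
   correction, so the 1 in [coefficient] is rewritten as that square. *)
have -> : coefficient = (delta * (a ^+ 2 + b ^+ 2) + 2 * a * b) ^+ 2 -
    a ^+ 2 * b ^+ 2 * (delta ^+ 2 - 1) by rewrite norm1 expr1n.
ring.
Qed.

(** Words of a grafted tree are words of [s] followed by shifted words of the caret tree. Weights
    and loop factors are multiplicative, so the fourfold sum splits into [local_sum] times the old
    pairing. *)
Lemma rdot_Phi_last n (s s' : tree n.+1) :
  rdot delta (Phi a b delta (last_forest caretl n \oF s))
    (Phi a b delta (last_forest caretr n \oF s')) =
  coefficient * rdot delta (Phi a b delta s) (Phi a b delta s').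
Proof.
rewrite !Phi_words // !forest_words_last.
have sE : strands (3 + n) = (n.*2 + 5)%N by rewrite /strands; lia.
have sE1 : strands n.+1 = (n.*2 + 1)%N by rewrite /strands; lia.
have nE (t : tree n.+1) : nodes t = n.
  by have := leavesE t; rewrite leaves_forest size_forest; lia.
rewrite !rdot_sum !nE.
rewrite big_allpairs_dep !sE !sE1 -local_sum mulr_sumr.
rewrite [LHS]big_seq [RHS]big_seq; apply: eq_bigr => w wf.
under eq_bigr => e _ do rewrite big_allpairs_dep.
rewrite exchange_big mulr_sumr /=.
rewrite [LHS]big_seq [RHS]big_seq; apply: eq_bigr => w' wf'.
rewrite mulr_suml [LHS]big_seq [RHS]big_seq; apply: eq_bigr => e ef.
rewrite mulr_suml [LHS]big_seq [RHS]big_seq; apply: eq_bigr => e' ef'.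
have words_spec (t : tree n.+1) u :
    u \in forest_words n t -> size u = n /\ valid 1 u.
  move=> uf; split; first exact: forest_words_size uf.
  by have := forest_words_valid (nE t) _ uf; rewrite size_forest; apply.
have [sw vw] := words_spec _ _ wf; have [sw' vw'] := words_spec _ _ wf'.
have /andP[/eqP se ve] := allP (isT : all (fun e => (size e == 2) && valid 1 e)
  (forest_words 2 [:: caretl])) _ ef.
have /andP[/eqP se' ve'] := allP (isT : all (fun e => (size e == 2) && valid 1 e)
  (forest_words 2 [:: caretr])) _ ef'.
rewrite rdot_rword_extend //; last first.
  (* Exhaustive check over the sixteen pairs of words and both bits. *)
  have loc : all (fun e => all (fun e' => all (fun t => local_count t e e' ==
      2 ^ local_loops e e')%N [:: true; false]) (forest_words 2 [:: caretr]))
      (forest_words 2 [:: caretl]) by vm_compute.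
  have /allP/(_ _ ef')/allP H := allP loc _ ef.
  by move=> t; apply/eqP/H; case: t.
rewrite !weight_real !weight_cat !weight_shift; ring.
Qed.

(** The same [p] and [q] serve all [s] and [s']; this uniformity lets one group element act on a
    whole [vacuum_span]. *)
Lemma rdot_Phi_pow n k : exists m (p q : forest n.+1 m.+1),
  forall s s' : tree n.+1,
    rdot delta (Phi a b delta (q \oF s)) (Phi a b delta (p \oF s')) =
    coefficient ^+ k * rdot delta (Phi a b delta s) (Phi a b delta s').
Proof.
elim: k => [|k [m [p [q IH]]]].
  by exists n, (fid n.+1), (fid n.+1) => s s'; rewrite !fcomp1f mul1r.
exists m.+2, (last_forest caretr m \oF p), (last_forest caretl m \oF q) => s s'.
by rewrite -!fcompA rdot_Phi_last IH exprS mulrA.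
Qed.

End Coefficient.

(** * Inner product spaces *)

Local Open Scope complex_scope.
Local Open Scope ring_scope.

Lemma rcomp_rword1 (R : realType) (delta : R[i]) m n w : valid m w ->
    n = (m + (size w).*2)%N ->
  rcomp delta (rword R m n w) (rword R m m [::]) = rword R m n w.
Proof.
move=> vw nE; have [d dw] := represents_exists vw nE.
have idw : represents (id_diagram m) [::].
  by apply/representsP => g f sg sf; rewrite compat_id // eq_sym.
rewrite (rwordE R dw) (rwordE R idw); move/representsP: dw => dw.
apply: rcomp_dbasis_unique => [g f|h h' f]; last first.
  by rewrite !dw ?size_tuple // => /eqP-> /eqP[] /val_inj.
split=> [H|[h]]; first by exists g; rewrite // compat_id ?size_tuple.
by rewrite compat_id ?size_tuple // => /eqP ->.
Qed.

Lemma tree_gt0 n : tree n -> (0 < n)%N.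
Proof.
case=> -[|t []] //= /eqP <-; rewrite leaves_cons.
exact: ltn_addr (tleaves_gt0 t).
Qed.

(** The action on the vacuum vector produces a composite with [Phi (fid 1)], the single strand,
    which is removed here. *)
Lemma rcomp_Phi1 (R : realType) (a b delta : R[i]) n (s : tree n) :
  rcomp delta (Phi a b delta s) (Phi a b delta (fid 1)) = Phi a b delta s.
Proof.
have nE : nodes s = n.-1.
  by have := leavesE s; rewrite leaves_forest size_forest; lia.
rewrite !Phi_words // [X in rcomp _ _ X]big_seq1 /weight big_nil scale1r.
rewrite rcomp_suml [LHS]big_seq [RHS]big_seq; apply: eq_bigr => w ws.
rewrite rcomp_rword1 //.
  by have := forest_words_valid erefl _ ws; rewrite size_forest; apply.
by rewrite (forest_words_size ws) nE /strands; have := tree_gt0 s; lia.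
Qed.

Section Span.
Variables (K : pzRingType) (V : lmodType K).
Implicit Types S T : set V.

Lemma lspan_gen S x : S x -> lspan S x.
Proof.
move=> Sx; exists 1%N, (fun=> 1), (fun=> x); split=> //.
by rewrite big_ord1 scale1r.
Qed.

Lemma lspan0 S : lspan S 0.
Proof.
by exists 0%N, (fun=> 0), (fun=> 0); split=> [[]//|]; rewrite big_ord0.
Qed.

Lemma lspan_linear S c x y : lspan S x -> lspan S y -> lspan S (c *: x + y).
Proof.
move=> [k [d [v [Sv ->]]]] [l [d' [v' [Sv' ->]]]].
exists (k + l)%N,
  (fun i => match fintype.split i with inl j => c * d j | inr j => d' j end),
  (fun i => match fintype.split i with inl j => v j | inr j => v' j end).
split=> [i|]; first by case: fintype.split.
rewrite big_split_ord scaler_sumr; congr (_ + _); apply: eq_bigr => i _.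
  case: split_ordP => j /eqP; rewrite ?eq_lshift ?eq_lrshift // => /eqP ->.
  by rewrite scalerA.
by case: split_ordP => j /eqP; rewrite ?eq_rshift ?eq_rlshift // => /eqP ->.
Qed.

Lemma lspan_ind S (P : V -> Prop) : P 0 ->
    (forall c x y, S x -> lspan S y -> P y -> P (c *: x + y)) ->
  forall x, lspan S x -> P x.
Proof.
move=> P0 PS x [k [c [v [Sv ->]]]].
suff [] : P (\sum_i c i *: v i) /\ lspan S (\sum_i c i *: v i) by [].
elim/big_rec: _ => [|i y _ [Py Sy]]; first by split=> //; apply: lspan0.
by split; [apply: PS | apply: lspan_linear => //; apply: lspan_gen].
Qed.

Lemma lspan_sub S T :
  (forall x, S x -> lspan T x) -> forall x, lspan S x -> lspan T x.
Proof.
move=> ST; apply: lspan_ind => [|c x y /ST Tx _ Ty]; first exact: lspan0.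
exact: lspan_linear.
Qed.

End Span.

Section InnerProduct.
Variables (R : realType) (H : completeNormedModType R[i]).
Variable dot : {dot H for Num.conj}.
Hypothesis dot_norm : forall x, `|x| ^+ 2 = dot x x.
Local Notation C := R[i].
Implicit Types x y : H.

Lemma dot_linearl (c : C) x y z : dot (c *: x + y) z = c * dot x z + dot y z.
Proof. exact: linearPl. Qed.

Lemma dot_linearr (c : C) x y z : dot z (c *: x + y) = c^* * dot z x + dot z y.
Proof. exact: linearPr. Qed.

Lemma dot0l z : dot 0 z = 0.
Proof. by have := dot_linearl (-1) 0 0 z; rewrite scaler0 addr0 mulN1r addNr. Qed.

Lemma dot0r z : dot z 0 = 0.
Proof.
by have := dot_linearr (-1) 0 0 z;
  rewrite scaler0 addr0 rmorphN1 mulN1r addNr.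
Qed.

Lemma dotC x y : dot x y = (dot y x)^*.
Proof. by have := hermC dot x y; rewrite expr0 mul1r. Qed.

Lemma dotBl x y z : dot (x - y) z = dot x z - dot y z.
Proof. by rewrite addrC -scaleN1r dot_linearl mulN1r addrC. Qed.

Lemma dotBr x y z : dot z (x - y) = dot z x - dot z y.
Proof. by rewrite addrC -scaleN1r dot_linearr rmorphN1 mulN1r addrC. Qed.

Lemma dot_suml m (c : 'I_m -> C) (x : 'I_m -> H) z :
  dot (\sum_i c i *: x i) z = \sum_i c i * dot (x i) z.
Proof.
elim/big_rec2: _ => [|i u v _ <-]; first exact: dot0l.
by rewrite dot_linearl.
Qed.

Lemma dot_sumr m (c : 'I_m -> C) (x : 'I_m -> H) z :
  dot z (\sum_i c i *: x i) = \sum_i (c i)^* * dot z (x i).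
Proof.
elim/big_rec2: _ => [|i u v _ <-]; first exact: dot0r.
by rewrite dot_linearr.
Qed.

Lemma cauchy_schwarz x y : `|dot x y| <= `|x| * `|y|.
Proof.
have [->|y0] := eqVneq y 0; first by rewrite dot0r normr0 mulr_ge0.
have n0 : 0 < dot y y by rewrite -dot_norm exprn_gt0 // normr_gt0.
rewrite -(ler_pXn2r (n := 2)) ?nnegrE ?mulr_ge0 // exprMn !dot_norm.
rewrite -ler_pdivrMr // -subr_ge0.
(* The right side is the squared norm of [x] minus its projection to the line of [y]. *)
have <- : dot (x - (dot x y / dot y y) *: y) (x - (dot x y / dot y y) *: y) =
    dot x x - `|dot x y| ^+ 2 / dot y y.
  rewrite -scaleNr addrC dot_linearl !dot_linearr (dotC y x) rmorphN rmorphM fmorphV.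
  rewrite /= -(dotC y y) normCK; move: (dot y y) n0 => d d0.
  by field; rewrite gt_eqF.
by rewrite -dot_norm exprn_ge0.
Qed.

(** The family is indexed by [nat] and only its first [m] members count, so a vector can be appended
    without a change of type. *)
Definition orthonormal_family m (e : nat -> H) : Prop :=
  forall i j : 'I_m, dot (e i) (e j) = (i == j)%:R.

Definition in_span m (e : nat -> H) (x : H) : Prop :=
  exists c : nat -> C, x = \sum_(i < m) c i *: e i.

Lemma in_span_linear m e c x y :
  in_span m e x -> in_span m e y -> in_span m e (c *: x + y).
Proof.
move=> [d ->] [d' ->]; exists (fun i => c * d i + d' i).
by rewrite scaler_sumr -big_split; apply: eq_bigr => i _; rewrite scalerDl scalerA.
Qed.

Lemma gram_schmidt k (v : nat -> H) : exists m e,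
  orthonormal_family m e /\ forall i : 'I_k, in_span m e (v i).
Proof.
elim: k => [|k [m [e [oe se]]]]; first by exists 0%N, (fun=> 0); split=> -[].
pose p := \sum_(i < m) dot (v k) (e i) *: e i.
have orth j : dot (v k - p) (e (j : 'I_m)) = 0.
  rewrite dotBl dot_suml (bigD1 j) //= oe eqxx mulr1 big1 ?addr0 ?subrr // => i ij.
  by rewrite oe (negbTE ij) mulr0.
have ordP (Q : nat -> Prop) l :
    (forall i : 'I_l, Q i) -> Q l -> forall i : 'I_l.+1, Q i.
  move=> Ql Qn i; have := ltn_ord i; rewrite ltnS leq_eqVlt => /orP[/eqP ->//|il].
  exact: (Ql (Ordinal il)).
have [/eqP vp|u0] := eqVneq (v k - p) 0.
  (* The new vector equals its projection, so the family is not enlarged. *)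
  exists m, e; split=> //; apply: (ordP (fun i => in_span m e (v i))) => //.
  by exists (fun i => dot (v k) (e i)); apply/eqP; rewrite -subr_eq0.
pose u := `|v k - p|^-1 *: (v k - p).
pose e' i := if (i < m)%N then e i else u.
have e'l (i : 'I_m) : e' i = e i by rewrite /e' ltn_ord.
have e'r : e' m = u by rewrite /e' ltnn.
have ue (i : 'I_m) : dot u (e i) = 0.
  by rewrite /u -[_ *: _]addr0 dot_linearl orth mulr0 dot0l addr0.
have uu : dot u u = 1.
  rewrite -dot_norm normrZ normrV ?unitfE ?normr_eq0 // normr_id.
  by rewrite mulVf ?expr1n // normr_eq0.
have span_ext x : in_span m e x -> in_span m.+1 e' x.
  move=> [c ->]; exists (fun i => if (i < m)%N then c i else 0).
  rewrite big_ord_recr /= ltnn scale0r addr0; apply: eq_bigr => i _.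
  by rewrite ltn_ord e'l.
exists m.+1, e'; split.
  have oe' (i : 'I_m.+1) (j : 'I_m.+1) :
      (val i <= val j)%N -> dot (e' i) (e' j) = (i == j)%:R.
    move=> ij; have [jm|mj] := ltnP j m.
      have im := leq_ltn_trans ij jm.
      by rewrite (e'l (Ordinal im)) (e'l (Ordinal jm)) oe.
    have -> : val j = m by apply/eqP; rewrite eqn_leq mj -ltnS ltn_ord.
    rewrite e'r; have [im|mi] := ltnP i m.
      rewrite (e'l (Ordinal im)) dotC ue rmorph0.
      by case: eqP => // ijE; move: mj; rewrite -ijE leqNgt im.
    have iE : val i = m by apply/eqP; rewrite eqn_leq mi -ltnS ltn_ord.
    rewrite iE e'r uu; case: eqP => // -[]; apply: val_inj.
    by apply/eqP; rewrite /= eqn_leq ij iE -ltnS ltn_ord.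
  move=> i j; case/orP: (leq_total i j) => ij; first exact: oe'.
  by rewrite dotC oe' // eq_sym rmorph_nat.
apply: (ordP (fun i => in_span m.+1 e' (v i))) => [i|]; first exact: span_ext.
have -> : v k = `|v k - p| *: u + p.
  by rewrite /u scalerA mulfV ?normr_eq0 // scale1r subrK.
apply: in_span_linear.
  exists (fun i => (i == m)%:R); rewrite big_ord_recr /= eqxx scale1r e'r.
  by rewrite big1 ?add0r // => i _; rewrite ltn_eqF // scale0r.
by apply: span_ext; exists (fun i => dot (v k) (e i)).
Qed.

(** The coefficient is the inner product with a unit vector. *)
Lemma orthonormal_coef m e (c : nat -> C) (j : 'I_m) :
  orthonormal_family m e -> `|c j| <= `|\sum_(i < m) c i *: e i|.
Proof.
move=> oe; have cE : dot (\sum_(i < m) c i *: e i) (e j) = c j.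
  rewrite dot_suml (bigD1 j) //= oe eqxx mulr1 big1 ?addr0 // => i ij.
  by rewrite oe (negbTE ij) mulr0.
have ej : `|e j| = 1.
  by apply/eqP; rewrite -[_ == _](eqrXn2 (n := 2)) // dot_norm oe eqxx expr1n.
by rewrite -{1}cE (le_trans (cauchy_schwarz _ _)) // ej mulr1.
Qed.

End InnerProduct.

(** * Weak mixing *)

Section Mixing.
Variables (R : realType) (delta a b : R[i]) (H : completeNormedModType R[i]).
Variable dot : {dot H for Num.conj}.
Variable iota : forall n, tree n -> Rec R 1 (strands n) -> H.
Variable rep : thompsonF -> {linear H -> H}.
Hypothesis jones : jones_representation delta a b dot iota rep.
Hypotheses (aR : a^* = a) (bR : b^* = b).
Hypothesis norm1 : delta * (a ^+ 2 + b ^+ 2) + 2 * a * b = 1.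
Local Notation C := R[i].

Let space := jones_rep_space jones.
Let dot_norm : forall x, `|x| ^+ 2 = dot x x := jones_norm space.

Definition vacuum : H := iota (fid 1) (Phi a b delta (fid 1)).

Lemma tree_space_Phi n (s : tree n) : tree_space delta a b (Phi a b delta s).
Proof. by apply: lspan_gen; exists s. Qed.

(** The trivial tree refines to [s] through [s] itself, and [s] needs no refinement. *)
Lemma rep_vacuum n (t s : tree n) :
  rep (Defs.frac t s) vacuum = iota t (Phi a b delta s).
Proof.
rewrite (@jones_rep_frac _ _ _ _ _ _ _ _ jones _ _ _ t s (fid 1) (fid n) s).
- by rewrite fcomp1f rcomp_Phi1.
- exact: tree_space_Phi.
- by rewrite fcomp1f fcompf1.
Qed.

Definition vacuum_span n (t : tree n) : set H :=
  lspan [set rep (Defs.frac t s) vacuum | s in [set: tree n]].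

Lemma iota_vacuum_span n (t : tree n) xi :
  tree_space delta a b xi -> vacuum_span t (iota t xi).
Proof.
(* [iota t] is linear on [tree_space] only, so its value at 0 comes from the case [c = -1] with both
   vectors zero. *)
have i0 : iota t 0 = 0.
  have := jones_linear space t (-1) (lspan0 _) (lspan0 _).
  by rewrite scaler0 addr0 => ->; rewrite scaleN1r addNr.
move: xi; apply: lspan_ind => [|c x y [s _ <-] ySp Hy].
  by rewrite i0; apply: lspan0.
rewrite (jones_linear space) //; last exact: tree_space_Phi.
by apply: lspan_linear => //; apply: lspan_gen; exists s; rewrite // rep_vacuum.
Qed.

Lemma vacuum_span_refine n m (t : tree n) (p : forest n m) x :
  vacuum_span t x -> vacuum_span (p \oF t) x.
Proof.
apply: lspan_sub => _ [s _ <-]; apply: lspan_gen; exists (p \oF s) => //.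
by rewrite frac_expand.
Qed.

Lemma common_vacuum_span m (x : nat -> H) :
    (forall i : 'I_m, exists n (t : tree n), vacuum_span t (x i)) ->
  exists n (t : tree n), forall i : 'I_m, vacuum_span t (x i).
Proof.
elim: m => [_|m IH Hx]; first by exists 1%N, (fid 1); case.
have [i|n [t Ht]] := IH; first exact: (Hx (widen_ord (leqnSn m) i)).
have [n' [t' Ht']] := Hx ord_max.
have [k [[p q] /= e]] := common_refinement t t'.
exists k, (p \oF t) => i; have := ltn_ord i.
rewrite ltnS leq_eqVlt => /orP[/eqP im|im].
  by rewrite im e; apply: vacuum_span_refine.
by apply: vacuum_span_refine; apply: (Ht (Ordinal im)).
Qed.

(** Take [g] with numerator [p \oF t] and denominator [q \oF t]. Expanding [t/s] by [q] and
    multiplying by [g] gives [(p \oF t)/(q \oF s)], while [t/s'] expands by [p] to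
    [(p \oF t)/(p \oF s')]. Both vectors now live at the tree [p \oF t] and pair by
    [rdot_Phi_pow]. *)
Lemma rep_coefficient n (t : tree n) k : exists g : thompsonF,
  forall x y, vacuum_span t x -> vacuum_span t y ->
    dot (rep g x) y = coefficient a b delta ^+ k * dot x y.
Proof.
case: n t => [/tree_gt0 //|n] t.
have [m [p [q pq]]] := rdot_Phi_pow aR bR norm1 n k.
exists (Defs.frac (p \oF t) (q \oF t)) => x y xS yS; move: x xS.
apply: lspan_ind => [|c _ x' [s _ <-] _ IHx].
  by rewrite linear0 !dot0l mulr0.
rewrite linearP !dot_linearl IHx mulrDr mulrCA; congr (c * _ + _) => {x' c IHx}.
move: y yS; apply: lspan_ind => [|c _ y' [s' _ <-] _ IHy].
  by rewrite !dot0r mulr0.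
rewrite !dot_linearr IHy mulrDr mulrCA; congr (_ * _ + _) => {y' c IHy}.
rewrite -(jones_rep_mul jones) -(frac_expand t s q) -(frac_expand t s' p).
rewrite [(_ * _)%g]thompson_mul_frac !rep_vacuum.
rewrite !(jones_isometry space); try exact: tree_space_Phi.
rewrite pq -(jones_isometry space t); try exact: tree_space_Phi.
by rewrite -!rep_vacuum !frac_expand.
Qed.

Lemma approx_vacuum_span x (e : C) : 0 < e ->
  exists y, `|x - y| < e /\ exists n (t : tree n), vacuum_span t y.
Proof.
move=> e0; have [|y [xy [n [t [xi [xiS yE]]]]]] :=
  jones_dense space _ (open_interior (ball x e)).
  by exists x; apply: nbhsx_ballx.
exists y; split.
  by have := interior_subset xy; rewrite -ball_normE.
by exists n, t; rewrite yE; apply: iota_vacuum_span.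
Qed.

Lemma rep_norm g x : `|rep g x| = `|x|.
Proof.
apply/eqP; rewrite -[_ == _](eqrXn2 (n := 2)) // !dot_norm.
by rewrite (jones_rep_unitary jones).
Qed.

(** An orthonormal family whose span contains [K] is approximated inside one [vacuum_span], where a
    suitable [g] multiplies all inner products by a small power of [coefficient]; unitarity controls
    the errors. *)
Lemma weak_mixing (eps : C) (K : set H) : 0 < eps -> findim_subspace K ->
    (forall h : C, 0 < h -> exists k, `|coefficient a b delta| ^+ k < h) ->
  exists g, forall eta zeta, K eta -> K zeta -> eta != 0 -> zeta != 0 ->
    `|dot (rep g eta) zeta| < eps * `|eta| * `|zeta|.
Proof.
move=> eps0 [k [v ->]] small.
(* The generators of [K] are extended by 0 to a family indexed by [nat]. *)
have [m [e [oe span_e]]] := gram_schmidt dot_norm k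
  (fun i => if insub i is Some j then v j else 0).
have {}span_e x : lspan (range v) x -> in_span m e x.
  apply: lspan_ind => [|c _ y [i _ <-] _ ye].
    by exists (fun=> 0); rewrite big1 // => i _; rewrite scale0r.
  by apply: in_span_linear => //; have := span_e i; rewrite valK.
have e1 (i : 'I_m) : `|e i| = 1.
  by apply/eqP; rewrite -[_ == _](eqrXn2 (n := 2)) // dot_norm oe eqxx expr1n.
(* The quotient [h = eps / d] is at most 1 because of the summand [eps], and [7 * m^2 * h < eps]
   because [d] exceeds [7 * m^2]. *)
pose d : C := 7%:R * (m * m)%:R + 7%:R + eps.
have d0 : 0 < d by rewrite ltr_wpDl // addr_ge0 ?mulr_ge0.
pose h := eps / d; have h0 : 0 < h by rewrite divr_gt0.
have h1 : h <= 1 by rewrite ler_pdivrMr // mul1r lerDr addr_ge0 ?mulr_ge0.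
have /choice[x Hx] (i : nat) : exists y, (i < m)%N -> `|e i - y| < h /\
    exists n (t : tree n), vacuum_span t y.
  by have [y Hy] := approx_vacuum_span (e i) h0; exists y.
have xe (i : 'I_m) : `|e i - x i| < h by have [] := Hx i (ltn_ord i).
have x2 (i : 'I_m) : `|x i| <= 2.
  rewrite -[x i](subKr (e i)) (le_trans (ler_normB _ _)) // e1 (_ : 2 = 1 + 1) // lerD2l.
  exact: le_trans (ltW (xe i)) h1.
have [n [t xt]] : exists n (t : tree n), forall i : 'I_m, vacuum_span t (x i).
  by apply: common_vacuum_span => i; have [] := Hx i (ltn_ord i).
have [l cl] := small h h0; have [g Hg] := rep_coefficient t l.
have cs := cauchy_schwarz dot_norm.
have bound (i j : 'I_m) : `|dot (rep g (e i)) (e j)| <= 7%:R * h.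
  (* Replacing [e i] and [e j] by [x i] and [x j] costs [h * 1] and [2 * h]; the main term is at
     most [h * (2 * 2)]. Together this is [7 * h]. *)
  have -> : dot (rep g (e i)) (e j) = dot (rep g (x i)) (x j) +
      (dot (rep g (e i - x i)) (e j) + dot (rep g (x i)) (e j - x j)).
    by rewrite linearB dotBl dotBr; ring.
  have -> : 7%:R * h = h * (2 * 2) + (h * 1 + 2 * h) by ring.
  rewrite (le_trans (ler_normD _ _)) // lerD //.
    rewrite Hg // normrM normrX ler_pM ?exprn_ge0 // ?(ltW cl) //.
    by rewrite (le_trans (cs _ _)) // ler_pM.
  rewrite (le_trans (ler_normD _ _)) // lerD // (le_trans (cs _ _)) // rep_norm.
    by rewrite e1 ler_pM // ltW.
  by rewrite ler_pM // ltW.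
exists g => y z /span_e[c yE] /span_e[c' zE] y0 z0.
have cy (i : 'I_m) : `|c i| <= `|y| by rewrite yE; apply: orthonormal_coef.
have cz (i : 'I_m) : `|c' i| <= `|z| by rewrite zE; apply: orthonormal_coef.
have yz0 : 0 < `|y| * `|z| by rewrite mulr_gt0 ?normr_gt0.
(* There are [m * m] matrix entries, each bounded by [7 * h], with coefficients bounded by the norms
   of [y] and [z]. *)
apply: (@le_lt_trans _ _ ((m * m)%:R * (7%:R * h * (`|y| * `|z|)))); last first.
  rewrite (_ : _%:R * _ = (m * m)%:R * 7%:R * h * (`|y| * `|z|)); last by ring.
  rewrite -[ltRHS]mulrA ltr_pM2r // /h mulrA ltr_pdivrMr // [ltLHS]mulrC.
  by rewrite ltr_pM2l // /d mulrC -addrA ltrDl ltr_wpDl.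
have -> : rep g y = \sum_(i < m) c i *: rep g (e i).
  by rewrite yE linear_sum; apply: eq_bigr => i _; rewrite linearZ.
rewrite dot_suml (le_trans (ler_norm_sum _ _ _)) // natrM -mulrA.
rewrite -[m in m%:R * _]card_ord mulr_natl -sumr_const ler_sum // => i _.
rewrite [in leLHS]zE dot_sumr normrM.
apply: le_trans (ler_wpM2l _ (ler_norm_sum _ _ _)) _ => //.
rewrite mulr_sumr -[m in m%:R * _]card_ord mulr_natl -sumr_const ler_sum // => j _.
rewrite normrM norm_conjC.
rewrite (_ : 7%:R * h * _ = `|y| * (`|z| * (7%:R * h))); last by ring.
by rewrite !ler_pM ?mulr_ge0.
Qed.

End Mixing.

(** * Numerical bounds and conclusion *)

Lemma jones_parameter_sqr (R : realType) (delta : R) :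
  (exists k : nat, (4 <= k)%N /\ delta = 2 * cos (pi / k%:R)) \/ 2 <= delta ->
  0 <= delta /\ 2 <= delta ^+ 2.
Proof.
case=> [[k [k4 ->]]|d2]; last by split; nra.
have k4R : (4 : R) <= k%:R by rewrite (ler_nat R 4).
have k0 : (0 : R) < k%:R by lra.
have p0 := pi_gt0 R.
have xk : (pi : R) / k%:R <= pi / 4 by rewrite ler_pM2l // lef_pV2 ?posrE //; lra.
have x0 : 0 <= (pi : R) / k%:R by rewrite divr_ge0 // ltW.
have c0 : 0 <= cos (pi / k%:R : R) by apply: cos_ge0_pihalf; lra.
(* By the double angle formula [delta ^+ 2 - 2] is [2 * cos (2 * pi / k)], and [2 * pi / k] is at
   most [pi / 2]. *)
have c2 : 0 <= cos ((pi / k%:R : R) *+ 2).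
  by apply: cos_ge0_pihalf; rewrite -mulr_natl; lra.
move: c2; rewrite cos_mulr2n => c2; split; first by lra.
by rewrite exprMn; move: (_ ^+ 2) c2 => y; rewrite -mulr_natl; lra.
Qed.

(** With [p = a * b] the claim is that [p ^+ 2 * (delta ^+ 2 - 1)] lies strictly between 0 and 2.
    Inserting [|2 * p| <= a ^+ 2 + b ^+ 2] in the normalization bounds [p] from both sides. *)
Lemma coefficient_norm_lt1 (R : realType) (delta a b : R) :
  0 <= delta -> 2 <= delta ^+ 2 -> a != 0 -> b != 0 ->
  delta * (a ^+ 2 + b ^+ 2) + 2 * a * b = 1 ->
  `|1 - a ^+ 2 * b ^+ 2 * (delta ^+ 2 - 1)| < 1.
Proof.
move=> d0 d2 a0 b0 n1; rewrite -exprMn.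
have p0 : 0 < (a * b) ^+ 2 by rewrite exprn_even_gt0 //= mulf_neq0.
(* A rational lower bound for the square root of 2. *)
have d14 : 7 / 5 <= delta by nra.
have am : 2 * a * b <= a ^+ 2 + b ^+ 2 by have := sqr_ge0 (a - b); lra.
have ap : - (2 * a * b) <= a ^+ 2 + b ^+ 2 by have := sqr_ge0 (a + b); lra.
have {am ap n1} [h1 h2] : 2 * (delta + 1) * (a * b) <= 1 /\
    - (2 * (delta - 1) * (a * b)) <= 1.
  by have := ler_wpM2l d0 am; have := ler_wpM2l d0 ap; split; lra.
move: (a * b) p0 h1 h2 => p p0 h1 h2 {a b a0 b0}.
have hi : p ^+ 2 * (delta ^+ 2 - 1) < 2.
  have [pp|pn] := leP 0 p.
    have : (2 * (delta + 1) * p) ^+ 2 <= 1 by rewrite expr_le1 //; nra.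
    nra.
  (* For negative [p] the factors [- p * (delta - 1)] and [- p * (delta + 1)] are at most 1/2 and 3,
     so their product is at most 3/2. *)
  have p1 : 2 * (- p * (delta - 1)) <= 1 by lra.
  have p2 : - p * (delta + 1) <= 3.
    have : - p <= 5 / 4 by nra.
    by lra.
  have : - p * (delta - 1) * (- p * (delta + 1)) <= 2^-1 * 3.
    by apply: ler_pM => //; [nra|nra|lra].
  by lra.
by rewrite ltr_norml; apply/andP; split; nra.
Qed.

Lemma small_exponent (R : realType) (r : R) (h : R[i]) : `|r| < 1 -> 0 < h ->
  exists k, `|r%:C| ^+ k < h.
Proof.
(* A positive complex number has zero imaginary part, so the claim reduces to a real geometric
   sequence. *)
move=> r1; rewrite ltcE /= => /andP[/eqP h0 hp].
have nr1 : `| `|r| | < 1 by rewrite normr_id.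
have [k _ Hk] := cvgr0_norm_lt _ (cvg_expr nr1) _ hp.
exists k; have := Hk k (leqnn k); rewrite normrX normr_id => rk.
by rewrite normc_def /= expr0n addr0 sqrtr_sqr -rmorphXn ltcE /= h0 eqxx.
Qed.

Theorem theorem3p5 (R : realType) (delta a b : R)
    (H : completeNormedModType R[i]) (dot : {dot H for Num.conj})
    (iota : forall n, tree n -> Rec R 1 (strands n) -> H)
    (rep : thompsonF -> {linear H -> H}) :
  (exists k : nat, (4 <= k)%N /\ delta = 2 * cos (pi / k%:R)) \/ 2 <= delta ->
  a != 0 -> b != 0 ->
  delta * (a ^+ 2 + b ^+ 2) + 2 * a * b = 1 ->
  jones_representation delta%:C a%:C b%:C dot iota rep ->
  (forall (eps : R) (K : set H), 0 < eps -> findim_subspace K ->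
     exists g : thompsonF, forall eta zeta : H,
       K eta -> K zeta -> eta != 0 -> zeta != 0 ->
       `|dot (rep g eta) zeta| < eps%:C * `|eta| * `|zeta|) /\
  ~ (exists K : set H, findim_subspace K /\
       (exists x, K x /\ x != 0) /\
       (forall (g : thompsonF) x, K x -> K (rep g x))).
Proof.
move=> /jones_parameter_sqr[d0 d2] a0 b0 n1 jones.
have c1 := coefficient_norm_lt1 d0 d2 a0 b0 n1.
have cE : coefficient a%:C b%:C delta%:C =
    (1 - a ^+ 2 * b ^+ 2 * (delta ^+ 2 - 1))%:C.
  by rewrite /coefficient rmorphB rmorphM rmorphB rmorphM !rmorphXn !rmorph1.
have n1C : delta%:C * (a%:C ^+ 2 + b%:C ^+ 2) + 2 * a%:C * b%:C = 1.
  have /(congr1 (real_complex R)) := n1.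
  by rewrite rmorphD !rmorphM rmorphD !rmorphXn rmorph_nat rmorph1.
have mixing (eps : R) (K : set H) : 0 < eps -> findim_subspace K ->
   exists g : thompsonF, forall eta zeta : H,
     K eta -> K zeta -> eta != 0 -> zeta != 0 ->
     `|dot (rep g eta) zeta| < eps%:C * `|eta| * `|zeta|.
  move=> e0 fK; apply: (weak_mixing jones (conjc_real a) (conjc_real b) n1C _ fK).
    by rewrite ltcR.
  by move=> h h0; rewrite cE; apply: small_exponent.
(* On an invariant [K] take [eta = x], [zeta = rep g x] and [eps = 1]: by unitarity the inner
   product equals the product of the norms, contradicting the strict bound. *)
split=> // -[K [fK [[x [Kx x0]] KK]]].
have [g /(_ x (rep g x) Kx (KK g x Kx) x0)] := mixing 1 K ltr01 fK.
have nx : `|rep g x| = `|x| := rep_norm jones g x.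
have -> : rep g x != 0 by rewrite -normr_eq0 nx normr_eq0.
rewrite -(jones_norm (jones_rep_space jones)) nx normrX normr_id mul1r expr2.
by rewrite ltxx => /(_ isT).
Qed.
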